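(* Let $0<t\le1$ be fixed, let $k<n_1$ be a positive integer with $tk<n_1$, and let $\lambda>0$, $\epsilon\ge0$. For $t<1$ put $\theta_1=\frac1t\sqrt{\frac{2-t}{1-t}}$, and put $\theta_2=\frac2t$. Suppose the restricted isometry constant of order $tk$ of the linear measurement map $\mathcal{A}:\mathbb{R}^{n_1\times n_2}\to\mathbb{R}^m$ satisfies $$\delta_{tk}<\begin{cases}\dfrac{(2-t)t}{(2-t)^2+2t\sqrt{(2-t)(1-t)}+(2-t)\theta_1}, & 0<t\le\frac23,\\[2mm] \dfrac{t^2}{2(t+1)}, & \frac23<t\le1.\end{cases}$$ Define $$\psi(\theta)=(2-t)t\theta-\left\{(2-t)[1+(2-t)\theta]+(1-t)t^2\theta^2\right\}\delta_{tk},$$ $$\varphi(\theta)=t\theta-\left[1+(2-t)\theta+\frac{t^2\theta^2}{4}\right]\delta_{tk},$$ and $$\widehat\beta_1=\begin{cases}\dfrac{\theta_1(2-t)\sqrt{t(1+\delta_{tk})}}{\psi(\theta_1)}, & 0<t\le\frac23,\\[2mm] \dfrac{\theta_2\sqrt{t(1+\delta_{tk})}}{\varphi(\theta_2)}, & \frac23<t\le1,\end{cases}\qquad \widehat\beta_2=\begin{cases}\theta_1\sqrt{\dfrac{(2-t)\delta_{tk}}{\psi(\theta_1)}}, & 0<t\le\frac23,\\[2mm] \theta_2\sqrt{\dfrac{\delta_{tk}}{\varphi(\theta_2)}}, & \frac23<t\le1.\end{cases}$$ Then for every $X\in\mathbb{R}^{n_1\times n_2}$, every $\bm{n}\in\mathbb{R}^m$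 with $\|\bm{n}\|_2\le\epsilon$, and $\bm{b}=\mathcal{A}(X)+\bm{n}$, any optimal solution $X^\sharp$ of $$\min_{Y\in\mathbb{R}^{n_1\times n_2}}\ \|Y\|_*+\frac{1}{2\lambda}\|\bm{b}-\mathcal{A}(Y)\|_2^2$$ satisfies $$\|X^\sharp-X\|_F\le C_3\|X-X_{[k]}\|_*+C_4,$$ where $$C_3=\frac{2\sqrt{k}\widehat\beta_1[3+3\widehat\beta_2+(\widehat\beta_2)^2]\lambda+2[1+4\widehat\beta_2+2(\widehat\beta_2)^2]\epsilon}{\sqrt{k}(1-\widehat\beta_2)(\sqrt{k}\widehat\beta_1\lambda+\epsilon)},$$ $$C_4=\frac{\sqrt{k}\widehat\beta_1(5+2\widehat\beta_2)\lambda+[1+4\widehat\beta_2+2(\widehat\beta_2)^2]\epsilon}{\sqrt{k}(1-\widehat\beta_2)\lambda}\left(\sqrt{k}\widehat\beta_1\lambda+\epsilon\right).$$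
   Context: Throughout $n_1\le n_2$. A linear measurement map is $\mathcal{A}(X)=[\mathrm{tr}(X^TA^{(1)}),\dots,\mathrm{tr}(X^TA^{(m)})]^T$ with fixed matrices $A^{(i)}\in\mathbb{R}^{n_1\times n_2}$. $\|\cdot\|_*$ is the nuclear norm, $\|\cdot\|_F$ the Frobenius norm, $\|\cdot\|_2$ the Euclidean norm. For a matrix $X$ with singular value decomposition $X=\sum_{i=1}^{n_1}\sigma_i\bm{a}^{(i)}(\bm{c}^{(i)})^T$, $\sigma_1\ge\dots\ge\sigma_{n_1}\ge0$, $X_{[k]}=\sum_{i=1}^k\sigma_i\bm{a}^{(i)}(\bm{c}^{(i)})^T$ denotes its best rank-$k$ approximation. ''Rank-$k$ matrix'' means a matrix of rank at most $k$. Restricted isometry constant: for a positive integer $k$, $\mathcal{A}$ satisfies the restricted isometry property (RIP) of order $k$ with restricted isometry constant $\delta_k$ if $\delta_k$ is the smallest $\delta\in(0,1)$ such that $(1-\delta)\|X\|_F^2\le\|\mathcal{A}(X)\|_2^2\le(1+\delta)\|X\|_F^2$ for every rank-$k$ matrix $X\in\mathbb{R}^{n_1\times n_2}$. For non-integer order $s$, $\delta_s:=\delta_{\lceil s\rceil}$.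
   Formalization: Assumes in addition tk > 1, so that the restricted isometry order ⌈tk⌉ is at least 2; for tk ≤ 1 the claim is false, since a linear map vanishing on the rank-two matrix diag(1,1,0,…) can have arbitrarily small δ_1. *)

(* Defs.v *)
From HB Require Import structures.
From mathcomp Require Import all_boot all_order all_algebra.
From mathcomp Require Import boolp classical_sets reals.

Set Implicit Arguments.
Unset Strict Implicit.
Unset Printing Implicit Defensive.

Import Order.TTheory GRing.Theory Num.Theory.
Local Open Scope classical_set_scope.
Local Open Scope ring_scope.

Section Matrices.
Variables (R : realType) (n1 n2 : nat).
Implicit Types (X : 'M[R]_(n1, n2)) (U : 'M[R]_n1) (V : 'M[R]_(n2, n1))
  (s : 'rV[R]_n1).

Definition l2norm (m : nat) (v : 'cV[R]_m) : R :=
  Num.sqrt (\sum_(i < m) v i 0 ^+ 2).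

Definition frobenius_norm X : R :=
  Num.sqrt (\sum_(i < n1) \sum_(j < n2) X i j ^+ 2).

(* The i-th left and right singular vectors are the i-th columns of U and V. *)
Definition svd_partial_sum (k : nat) U s V : 'M[R]_(n1, n2) :=
  \sum_(i < n1 | (i < k)%N) s 0 i *: (col i U *m (col i V)^T).

(* Thin singular value decomposition. One exists for every X exactly when
   n1 <= n2, since V has n1 orthonormal columns in R^n2. *)
Definition is_svd X U s V : Prop :=
  [/\ U^T *m U = 1%:M,
      V^T *m V = 1%:M,
      forall i, 0 <= s 0 i,
      forall i j : 'I_n1, (i <= j)%N -> s 0 j <= s 0 i &
      X = svd_partial_sum n1 U s V].

(* For n1 <= n2 the set below is a singleton, so the default 0 is not used. *)
Definition singular_values X : 'rV[R]_n1 :=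
  xget 0 [set s | exists U V, is_svd X U s V].

Definition nuclear_norm X : R := \sum_(i < n1) singular_values X 0 i.

Section MeasurementMap.
Variables (m : nat) (A : 'I_m -> 'M[R]_(n1, n2)).

Definition measure_map X : 'cV[R]_m := \col_i \tr (X^T *m A i).

Definition RIP (k : nat) (delta : R) : Prop :=
  forall X, (\rank X <= k)%N ->
    (1 - delta) * frobenius_norm X ^+ 2 <= l2norm (measure_map X) ^+ 2 /\
    l2norm (measure_map X) ^+ 2 <= (1 + delta) * frobenius_norm X ^+ 2.

Definition is_RIC_nat (k : nat) (delta : R) : Prop :=
  [/\ 0 < delta < 1,
      RIP k delta &
      forall delta', 0 < delta' < 1 -> RIP k delta' -> delta <= delta'].

(* The absolute value only casts the integer ceiling to nat; it is meant for
   orders s > 0. *)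
Definition is_RIC (s delta : R) : Prop := is_RIC_nat `|Num.ceil s|%N delta.

Definition objective (lambda : R) (b : 'cV[R]_m) (Y : 'M[R]_(n1, n2)) : R :=
  nuclear_norm Y + (2 * lambda)^-1 * l2norm (b - measure_map Y) ^+ 2.

Definition optimal_solution (lambda : R) (b : 'cV[R]_m) X : Prop :=
  forall Y, objective lambda b X <= objective lambda b Y.

End MeasurementMap.
End Matrices.

Section Constants.
Variable R : realType.
Implicit Types t delta theta : R.

Definition theta1 t : R := t^-1 * Num.sqrt ((2 - t) / (1 - t)).

Definition theta2 t : R := 2 / t.

Definition ric_bound t : R :=
  if t <= 2 / 3 then
    (2 - t) * t /
    ((2 - t) ^+ 2 + 2 * t * Num.sqrt ((2 - t) * (1 - t)) + (2 - t) * theta1 t)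
  else t ^+ 2 / (2 * (t + 1)).

Definition psi t delta theta : R :=
  (2 - t) * t * theta -
  ((2 - t) * (1 + (2 - t) * theta) + (1 - t) * t ^+ 2 * theta ^+ 2) * delta.

Definition phi t delta theta : R :=
  t * theta - (1 + (2 - t) * theta + t ^+ 2 * theta ^+ 2 / 4) * delta.

Definition beta1 t delta : R :=
  if t <= 2 / 3 then
    theta1 t * (2 - t) * Num.sqrt (t * (1 + delta)) / psi t delta (theta1 t)
  else theta2 t * Num.sqrt (t * (1 + delta)) / phi t delta (theta2 t).

Definition beta2 t delta : R :=
  if t <= 2 / 3 then
    theta1 t * Num.sqrt ((2 - t) * delta / psi t delta (theta1 t))
  else theta2 t * Num.sqrt (delta / phi t delta (theta2 t)).

Definition C3 (k : nat) (b1 b2 lambda eps : R) : R :=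
  let sk := Num.sqrt k%:R in
  (2 * sk * b1 * (3 + 3 * b2 + b2 ^+ 2) * lambda +
   2 * (1 + 4 * b2 + 2 * b2 ^+ 2) * eps) /
  (sk * (1 - b2) * (sk * b1 * lambda + eps)).

Definition C4 (k : nat) (b1 b2 lambda eps : R) : R :=
  let sk := Num.sqrt k%:R in
  (sk * b1 * (5 + 2 * b2) * lambda + (1 + 4 * b2 + 2 * b2 ^+ 2) * eps) /
  (sk * (1 - b2) * lambda) * (sk * b1 * lambda + eps).

End Constants.

(* Main.v *)
Require Import Defs.
From HB Require Import structures.
From mathcomp Require Import all_boot all_order all_algebra.
From mathcomp Require Import fingroup perm.
From mathcomp Require Import boolp classical_sets reals.
From mathcomp Require Import fintype finset complex zify ring lra.

(** Put H = Xs - X, with singular value decomposition H = sum_i h_i a_i c_i^T and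
    z_i = A(a_i c_i^T). Among the matrices sum_i x_i a_i c_i^T the rank is the
    sparsity of x and the Frobenius norm its Euclidean norm, so the restricted
    isometry property of A becomes that of the vectors z_i for sparse vectors of
    coefficients ([RIP_sparse]), of order r = ceil (t k) >= 2. Call head the k
    largest singular values of H and tail the others; let N be the norm of the head
    and tau the sum of the tail divided by sqrt k.

    The main step is the robust null space property
    N <= beta1 |A(H)| + beta2 tau ([sparse_null_space_property]). It comes from
    bounding <B h_head, B h> from below, B being the linear map given by the z_i.
    - For <B h_head, B h_head>, the lower isometry bounds on the r-subsets of the
      head are averaged, and so are the upper bounds on the differences
      h_i z_i - h_j z_j. The combination of the two in which the diagonal of the Gram
      matrix drops out costs delta (2 k / r - 1) N^2 ([gram_lower]).
    - For <B h_head, B h_tail>, vectors with disjoint supports of total size at most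
      r are nearly orthogonal. The head is averaged over its subsets of about r / 2
      elements, and the tail is replaced by a sparse extreme point of a polytope that
      contains it ([head_tail_ge], [cross_term]).
    Together with the upper bound by |B h_head| |A(H)| this gives a quadratic inequality
    for N, whose solution has the constants beta1 and beta2; the bound assumed on
    delta is exactly beta2 < 1.

    On the other side, optimality of Xs gives
    |A(H)|^2 - 2 eps |A(H)| <= 2 lambda (|X|_* - |Xs|_* )
    ([optimality_inequality]), and the difference of nuclear norms is at most
    2 |X - X_[k]|_* + |H_head|_* - |H_tail|_* ([nuclear_norm_cone]). The latter
    follows from Mirsky's inequality sum_i |sigma_i(Y) - sigma_i(Z)| <= |Y - Z|_*
    ([mirsky_nuclear]), proved by dominating the symmetric dilations of Y and Z by a
    common matrix and comparing eigenvalues with the trace. It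
    rests on the existence and uniqueness of singular values ([svd_exists],
    [singular_valuesE]).

    The theorem then follows by elementary algebra ([error_arithmetic]). *)

Set Implicit Arguments.
Unset Strict Implicit.
Unset Printing Implicit Defensive.

Import Order.TTheory GRing.Theory Num.Theory.
Local Open Scope ring_scope.

(** * The trace inner product *)

Definition mxdot (R : realType) m n (A B : 'M[R]_(m, n)) : R := \tr (A *m B^T).

Local Notation "''[' A , B ]" := (mxdot A B) : ring_scope.

Section MxDot.
Variable R : realType.

Section Bilinear.
Variables m n : nat.
Implicit Types A B C : 'M[R]_(m, n).

Lemma mxdotE A B : '[A, B] = \sum_i \sum_j A i j * B i j.
Proof. by apply: eq_bigr => i _; rewrite !mxE; apply: eq_bigr => j _; rewrite mxE. Qed.

Lemma mxdotC A B : '[A, B] = '[B, A].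
Proof. by rewrite /mxdot -mxtrace_tr trmx_mul trmxK. Qed.

Lemma mxdotDl A B C : '[A + B, C] = '[A, C] + '[B, C].
Proof. by rewrite /mxdot mulmxDl mxtraceD. Qed.

Lemma mxdotZl a A B : '[a *: A, B] = a * '[A, B].
Proof. by rewrite /mxdot -scalemxAl mxtraceZ. Qed.

Lemma mxdotDr A B C : '[A, B + C] = '[A, B] + '[A, C].
Proof. by rewrite mxdotC mxdotDl ![mxdot _ A]mxdotC. Qed.

Lemma mxdotZr a A B : '[A, a *: B] = a * '[A, B].
Proof. by rewrite mxdotC mxdotZl mxdotC. Qed.

Lemma mxdotNl A B : '[- A, B] = - '[A, B].
Proof. by rewrite -scaleN1r mxdotZl mulN1r. Qed.

Lemma mxdotNr A B : '[A, - B] = - '[A, B].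
Proof. by rewrite mxdotC mxdotNl mxdotC. Qed.

Lemma mxdot0l A : '[0, A] = 0.
Proof. by rewrite -(scale0r 0) mxdotZl mul0r. Qed.

Lemma mxdot_suml I r (P : pred I) F B :
  '[\sum_(i <- r | P i) F i, B] = \sum_(i <- r | P i) '[F i, B].
Proof.
by apply: (big_morph (fun A => mxdot A B)) => [A C|]; rewrite ?mxdotDl ?mxdot0l.
Qed.

Lemma mxdot_sumr I r (P : pred I) F B :
  '[B, \sum_(i <- r | P i) F i] = \sum_(i <- r | P i) '[B, F i].
Proof. by rewrite mxdotC mxdot_suml; apply: eq_bigr => i _; exact: mxdotC. Qed.

Lemma mxdot_ge0 A : 0 <= '[A, A].
Proof.
rewrite mxdotE; apply: sumr_ge0 => i _; apply: sumr_ge0 => j _.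
by rewrite -expr2 sqr_ge0.
Qed.

Lemma mxdot_eq0 A : ('[A, A] == 0) = (A == 0).
Proof.
apply/eqP/eqP => [|->]; last by rewrite mxdot0l.
have p i j : 0 <= A i j * A i j by rewrite -expr2 sqr_ge0.
rewrite mxdotE => /eqP; rewrite psumr_eq0 => [/allP h|i _]; last exact: sumr_ge0.
apply/matrixP => i j; move: (h i (mem_index_enum i)) => /=.
rewrite psumr_eq0 => [/allP/(_ j (mem_index_enum j))|//].
by rewrite /= -expr2 sqrf_eq0 => /eqP->; rewrite mxE.
Qed.

Lemma mxdot_gt0 A : A != 0 -> 0 < '[A, A].
Proof. by move=> A0; rewrite lt0r mxdot_eq0 A0 mxdot_ge0. Qed.

End Bilinear.

Lemma mxdot_mulr m n p (M : 'M[R]_(n, p)) (A : 'M_(m, n)) B :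
  '[A *m M, B] = '[A, B *m M^T].
Proof. by rewrite /mxdot trmx_mul trmxK mulmxA. Qed.

Lemma mxdot_tr m n (A B : 'M[R]_(m, n)) : '[A^T, B^T] = '[A, B].
Proof. by rewrite /mxdot trmxK mxtrace_mulC -mxtrace_tr trmx_mul trmxK. Qed.

Lemma mxdot_rV n (u v : 'rV[R]_n) : '[u, v] = \sum_j u 0 j * v 0 j.
Proof. by rewrite mxdotE big_ord1. Qed.

Lemma mxdot_cV n (u v : 'cV[R]_n) : '[u, v] = \sum_j u j 0 * v j 0.
Proof. by rewrite mxdotE; apply: eq_bigr => i _; rewrite big_ord1. Qed.

Lemma mxdot_row_mx n p (u v : 'rV[R]_n) (x y : 'rV[R]_p) :
  '[row_mx u x, row_mx v y] = '[u, v] + '[x, y].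
Proof. by rewrite /mxdot tr_row_mx mul_row_col mxtraceD. Qed.

(** Common source of the Cauchy-Schwarz inequality and of the near-orthogonality of
    images of disjointly supported vectors: both arise from a quantity that stays
    nonnegative along a line. *)
Lemma discr_le0 (a b c : R) :
  (forall x, 0 <= a + 2 * b * x + c * x ^+ 2) -> b ^+ 2 <= a * c.
Proof.
move=> h; have [c0|c0|c0] := ltrgt0P c.
- have := h (- b / c); have cn : c != 0 by rewrite gt_eqF.
  have -> : a + 2 * b * (- b / c) + c * (- b / c) ^+ 2 = (a * c - b ^+ 2) / c.
    by field.
  by rewrite pmulr_lge0 ?invr_gt0// subr_ge0.
- have := h ((`|a| + 2 * `|b| + 1) * (1 - c^-1)).
  have ci : c^-1 < 0 by rewrite invr_lt0.
  set d := 1 - c^-1; have d1 : 1 <= d by rewrite /d; lra.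
  have cd : c * d <= -1.
    by rewrite /d mulrBr mulr1 mulfV ?lt_eqF//; lra.
  move=> k; exfalso; move: k; apply/negP; rewrite -ltNge.
  set g := `|a| + _ + 1.
  have ha := ler_norm a; have hb := ler_norm b; have a0 := normr_ge0 a.
  have b0 := normr_ge0 b.
  have g1 : 1 <= g by rewrite /g; lra.
  have -> : a + 2 * b * (g * d) + c * (g * d) ^+ 2 = a + g * d * (2 * b + g * (c * d)).
    by ring.
  have h1 : 2 * b + g * (c * d) <= - (`|a| + 1).
    have : g * (c * d) <= g * (-1) by rewrite ler_wpM2l//; lra.
    by rewrite {2}/g; lra.
  have h2 : 1 <= g * d by rewrite -[1]mulr1 ler_pM//; lra.
  have : g * d * (2 * b + g * (c * d)) <= - (`|a| + 1).
    by nra.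
  by lra.
rewrite c0 mulr0; have [->|b0] := eqVneq b 0; first by rewrite expr0n.
have := h (- (a + 1) / (2 * b)); rewrite c0 mul0r addr0.
have -> : 2 * b * (- (a + 1) / (2 * b)) = - (a + 1) by field.
by move=> k; exfalso; lra.
Qed.

Lemma mxdot_CS m n (A B : 'M[R]_(m, n)) : '[A, B] ^+ 2 <= '[A, A] * '[B, B].
Proof.
apply: discr_le0 => x; have := mxdot_ge0 (A + x *: B).
rewrite mxdotDl !mxdotDr !mxdotZl !mxdotZr (mxdotC B A).
by rewrite (_ : _ + _ = '[A, A] + 2 * '[A, B] * x + '[B, B] * x ^+ 2)//; ring.
Qed.

Lemma mxdot_isometry n p q (v : 'M[R]_(q, p)) (K : 'M[R]_(n, p)) :
  K^T *m K = 1%:M -> '[v *m K^T, v *m K^T] = '[v, v].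
Proof. by move=> KK; rewrite mxdot_mulr trmxK -mulmxA KK mulmx1. Qed.

Lemma bessel n p (v : 'rV[R]_n) (K : 'M[R]_(n, p)) :
  K^T *m K = 1%:M -> '[v *m K, v *m K] <= '[v, v].
Proof.
move=> KK; have := mxdot_ge0 (v - v *m K *m K^T).
have e : '[v *m K *m K^T, v *m K *m K^T] = '[v *m K, v *m K].
  by rewrite mxdot_mulr trmxK -!mulmxA KK mulmx1.
have e' : '[v, v *m K *m K^T] = '[v *m K, v *m K].
  by rewrite mxdotC mxdot_mulr trmxK.
rewrite mxdotDl !mxdotDr !mxdotNl !mxdotNr e e' (mxdotC _ v) e'; lra.
Qed.

End MxDot.

(** * Symmetric eigenvectors and orthonormal completion *)

Section SVD.
Variable R : realType.

(** The characteristic polynomial has a complex root; symmetry makes it real, and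
    then the real and imaginary parts of a complex eigenvector are eigenvectors
    unless they vanish. *)
Lemma sym_eigenvector n (S : 'M[R]_n.+1) : S^T = S ->
  exists (v : 'rV_n.+1) (a : R), v != 0 /\ v *m S = a *: v.
Proof.
move=> St; pose Sc : 'M[R[i]]_n.+1 := map_mx (real_complex R) S.
have /closed_rootP[[p q]] : size (char_poly Sc) != 1 by rewrite size_char_poly.
rewrite -eigenvalue_root_char => /eigenvalueP[z zS z0].
pose x : 'rV[R]_n.+1 := \row_j complex.Re (z 0 j).
pose y : 'rV[R]_n.+1 := \row_j complex.Im (z 0 j).
have ezS j : \sum_k z 0 k * (S k j)%:C%C = (p +i* q)%C * z 0 j.
  move/matrixP/(_ 0 j): zS; rewrite !mxE => <-.
  by apply: eq_bigr => k _; rewrite mxE.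
have ReM (c d : R[i]) : complex.Re (c * d) =
    complex.Re c * complex.Re d - complex.Im c * complex.Im d.
  by case: c => ? ?; case: d.
have ImM (c d : R[i]) : complex.Im (c * d) =
    complex.Re c * complex.Im d + complex.Im c * complex.Re d.
  by case: c => ? ?; case: d.
have xS : x *m S = p *: x - q *: y.
  apply/rowP => j; have /(congr1 (@complex.Re R)) := ezS j.
  rewrite ReM !mxE => <-.
  rewrite (big_morph (@complex.Re R) (id1 := 0) (op1 := +%R)) => [|[? ?] [? ?]|]//.
  by apply: eq_bigr => k _; rewrite ReM !mxE/= mulr0 subr0.
have yS : y *m S = q *: x + p *: y.
  apply/rowP => j; have /(congr1 (@complex.Im R)) := ezS j.
  rewrite ImM !mxE [RHS]addrC => <-.
  rewrite (big_morph (@complex.Im R) (id1 := 0) (op1 := +%R)) => [|[? ?] [? ?]|]//.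
  by apply: eq_bigr => k _; rewrite ImM !mxE/= mulr0 add0r.
(* symmetry of S forces the eigenvalue p + iq to be real *)
have sum0 : q * ('[x, x] + '[y, y]) = 0.
  have : '[x *m S, y] = '[x, y *m S] by rewrite mxdot_mulr St.
  rewrite xS yS mxdotDl mxdotNl mxdotDr !mxdotZl !mxdotZr => h.
  by lra.
have xy0 : '[x, x] + '[y, y] != 0.
  rewrite paddr_eq0 ?mxdot_ge0// !mxdot_eq0; apply: contraNN z0 => /andP[/eqP x0 /eqP y0].
  apply/eqP/rowP => j; rewrite mxE; move/rowP/(_ j): x0; move/rowP/(_ j): y0.
  by rewrite !mxE; case: (z 0 j) => a b /= -> ->.
have q0 : q = 0 by move/eqP: sum0; rewrite mulf_eq0 (negPf xy0) orbF => /eqP.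
rewrite q0 !scale0r ?subr0 ?add0r in xS yS.
have [x0|x0] := eqVneq x 0; last by exists x, p.
exists y, p; split=> //; move: xy0; rewrite x0 mxdot0l add0r.
by rewrite mxdot_eq0.
Qed.

(** Householder's reflection through the hyperplane orthogonal to u - e_0
    exchanges u and e_0. *)
Lemma ortho_completion n (u : 'rV[R]_n.+1) : '[u, u] = 1 ->
  exists Q : 'M[R]_n.+1, Q^T *m Q = 1%:M /\ row 0 Q = u.
Proof.
move=> u1; pose e : 'rV[R]_n.+1 := delta_mx 0 0.
have e1 : '[e, e] = 1.
  by rewrite mxdot_rV (bigD1 0)//= big1 ?mxE ?eqxx ?mulr1 ?addr0// => j /negPf h;
     rewrite mxE h mul0r.
have [<-|ue] := eqVneq e u.
  by exists 1%:M; rewrite trmx1 mulmx1; split=> //; rewrite row1.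
pose w := e - u; pose d := '[w, w].
have d0 : d != 0 by rewrite mxdot_eq0 subr_eq0.
have dE : d = 2 * '[e, w].
  rewrite /d /w mxdotDl !mxdotDr !mxdotNl !mxdotNr u1 e1 (mxdotC u e); ring.
have ww : w *m w^T = d%:M by rewrite [LHS]mx11_scalar /d /mxdot /mxtrace big_ord1.
have ew : e *m w^T = ('[e, w])%:M by rewrite [LHS]mx11_scalar /mxdot /mxtrace big_ord1.
have [P PE] : exists P, P = w^T *m w by exists (w^T *m w).
have Pt : P^T = P by rewrite PE trmx_mul trmxK.
have PP : P *m P = d *: P.
  by rewrite PE mulmxA -(mulmxA w^T) ww mul_mx_scalar scalemxAl.
pose Q : 'M[R]_n.+1 := 1%:M - (2 / d) *: P.
have Qt : Q^T = Q by apply/matrixP => i j; rewrite !mxE eq_sym -{1}Pt [in LHS]mxE.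
exists Q; split.
  rewrite Qt /Q mulmxBl !mulmxBr !mul1mx mulmx1.
  rewrite -!(scalemxAl, scalemxAr) PP !scalerA -addrA -opprD -scalerBl -scalerDl.
  by rewrite (_ : 2 / d + _ = 0) ?scale0r ?subr0//; field.
have -> : row 0 Q = e *m Q by rewrite rowE.
rewrite /Q mulmxBr mulmx1 -scalemxAr PE mulmxA ew mul_scalar_mx scalerA.
have -> : 2 / d * '[e, w] = 1 by rewrite mulrAC -dE mulfV.
by rewrite scale1r /w opprB addrC subrK.
Qed.

End SVD.

(** * Existence of singular value decompositions *)

Section SVDExistence.
Variable R : realType.

Lemma normalize_rV n (v : 'rV[R]_n) : v != 0 ->
  exists c, '[c *: v, c *: v] = 1.
Proof.
move=> v0; exists (Num.sqrt '[v, v])^-1.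
rewrite mxdotZl mxdotZr mulrA -invfM -expr2 sqr_sqrtr ?mxdot_ge0//.
by rewrite mulVf// mxdot_eq0.
Qed.

(** An eigenvector of X X^T gives the left vector.  When its eigenvalue is 0 the
    right vector comes from the kernel of X^T, which is nonzero because X has at
    least as many columns as rows and is not of full row rank. *)
Lemma singular_pair n1 n2 (X : 'M[R]_(n1.+1, n2.+1)) : (n1 <= n2)%N ->
  exists (u : 'rV_n1.+1) (v : 'rV_n2.+1) (sg : R), [/\ '[u, u] = 1, '[v, v] = 1, 0 <= sg,
    u *m X = sg *: v & v *m X^T = sg *: u].
Proof.
move=> n12.
have [|x [a [x0 xS]]] := @sym_eigenvector _ _ (X *m X^T).
  by rewrite trmx_mul trmxK.
have [c] := normalize_rV x0; set u := c *: x => u1.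
have uS : u *m (X *m X^T) = a *: u by rewrite -scalemxAl xS scalerA mulrC -scalerA.
have aE : a = '[u *m X, u *m X].
  by rewrite mxdot_mulr mxdotC -mulmxA uS mxdotZl u1 mulr1.
have [uX0|uX0] := eqVneq (u *m X) 0.
  have rX : (\rank X < n1.+1)%N.
    rewrite ltn_neqAle rank_leq_row andbT; apply/negP => fX.
    have := mulmx_free_eq0 u (fX : row_free X); rewrite uX0 eqxx => /esym/eqP u0.
    by move: u1; rewrite u0 mxdot0l => /eqP; rewrite eq_sym oner_eq0.
  have : kermx X^T != 0.
    rewrite kermx_eq0 /row_free mxrank_tr neq_ltn (leq_trans rX)//.
  case/rowV0Pn => y /sub_kermxP yX y0; have [d y1] := normalize_rV y0.
  exists u, (d *: y), 0; split => //; first by rewrite uX0 scale0r.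
  by rewrite -scalemxAl yX scaler0 scale0r.
have a0 : 0 < a by rewrite aE mxdot_gt0.
have sa : Num.sqrt a != 0 by rewrite sqrtr_eq0 -ltNge.
exists u, ((Num.sqrt a)^-1 *: (u *m X)), (Num.sqrt a); split => //.
- rewrite mxdotZl mxdotZr mulrA -invfM -expr2 sqr_sqrtr ?ltW// -aE mulVf// gt_eqF//.
- by rewrite sqrtr_ge0.
- by rewrite scalerA mulfV// scale1r.
- rewrite -scalemxAl -mulmxA uS scalerA -{2}(sqr_sqrtr (ltW a0)) expr2 mulrA.
  by rewrite mulVf// mul1r.
Qed.

(** The order of the singular values is restored at the end by a permutation, so
    that constructions of decompositions need not care about it. *)
Definition unsorted_svd n1 n2 (X : 'M[R]_(n1, n2)) U (s : 'rV_n1) V :=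
  [/\ U^T *m U = 1%:M, V^T *m V = 1%:M, forall i, 0 <= s 0 i &
      X = U *m diag_mx s *m V^T].

(** In orthonormal bases that start with a singular pair the matrix is block
    diagonal, and the remaining block is decomposed by induction. *)
Lemma unsorted_svd_exists n1 n2 (X : 'M[R]_(n1, n2)) : (n1 <= n2)%N ->
  exists U s V, unsorted_svd X U s V.
Proof.
elim: n1 n2 X => [|n1 IH] n2 X.
  by move=> _; exists 1%:M, 0, 0; split; [rewrite !flatmx0 | rewrite !flatmx0
     | case | rewrite !flatmx0].
case: n2 X => // n2 X; rewrite ltnS => n12.
have [u [v [sg [u1 v1 sg0 uX vX]]]] := singular_pair X n12.
have [P [PP Pu]] := ortho_completion u1.
have [Q [QQ Qv]] := ortho_completion v1.
have PP' : P *m P^T = 1%:M by exact: mulmx1C.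
have QQ' : Q *m Q^T = 1%:M by exact: mulmx1C.
have [Y YP] : exists Y : 'M_(1 + n1, 1 + n2), Y = P *m X *m Q^T by eexists.
have Yr : row 0 Y = sg *: row 0 1%:M.
  by rewrite YP !row_mul Pu uX -scalemxAl -Qv -row_mul QQ'.
have Yc : row 0 Y^T = sg *: row 0 1%:M.
  by rewrite YP !trmx_mul trmxK mulmxA !row_mul Qv vX -scalemxAl -Pu -row_mul PP'.
have Yb : Y = block_mx sg%:M 0 0 (drsubmx Y).
  rewrite -[LHS]submxK; congr block_mx; apply/matrixP => i j.
  - move/rowP/(_ 0): Yr; rewrite !ord1 !mxE /= mulr1 mulr1n => <-.
    by congr (Y _ _); apply: val_inj.
  - move/rowP/(_ (rshift 1 j)): Yr; rewrite !ord1 !mxE /= mulr0 => <-.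
    by congr (Y _ _); apply: val_inj.
  - move/rowP/(_ (rshift 1 i)): Yc; rewrite !ord1 !mxE /= mulr0 => <-.
    by congr (Y _ _); apply: val_inj.
have [U' [s' [V' [UU VV s0 YE]]]] := IH _ (drsubmx Y) n12.
pose BU : 'M_(1 + n1) := block_mx 1%:M 0 0 U'.
pose BV : 'M_(1 + n2, 1 + n1) := block_mx 1%:M 0 0 V'.
pose S : 'rV_(1 + n1) := row_mx sg%:M s'.
have ortho p q (W : 'M[R]_(p, q)) : W^T *m W = 1%:M ->
    (block_mx 1%:M 0 0 W : 'M_(1 + p, 1 + q))^T *m block_mx 1%:M 0 0 W = 1%:M.
  move=> h; rewrite tr_block_mx mulmx_block !trmx0 !mulmx0 !mul0mx trmx1 mulmx1.
  by rewrite !(add0r, addr0) h -scalar_mx_block.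
have YS : Y = BU *m diag_mx S *m BV^T.
  rewrite Yb /BU /BV /S diag_mx_row tr_block_mx !mulmx_block !trmx0 trmx1.
  rewrite !(mulmx0, mul0mx, mulmx1, mul1mx, addr0, add0r) -YE.
  by congr block_mx; apply/matrixP => i j; rewrite !ord1 !mxE !eqxx.
exists (P^T *m BU), S, (Q^T *m BV); split.
- by rewrite trmx_mul trmxK -mulmxA (mulmxA P) PP' mul1mx ortho.
- by rewrite trmx_mul trmxK -mulmxA (mulmxA Q) QQ' mul1mx ortho.
- move=> i; rewrite mxE; case: splitP => j _; last exact: s0.
  by rewrite (ord1 j) mxE eqxx mulr1n.
- have -> : X = P^T *m Y *m Q.
    by rewrite YP !mulmxA PP mul1mx -mulmxA QQ mulmx1.
  by rewrite YS trmx_mul trmxK !mulmxA.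
Qed.

End SVDExistence.

(** * Variational bounds and uniqueness of singular values *)

Section SingularValues.
Variable R : realType.

Lemma mulmx_diag_sum n1 n2 q (U : 'M[R]_(n1, q)) (x : 'rV_q) (V : 'M_(n2, q)) :
  U *m diag_mx x *m V^T = \sum_i x 0 i *: (col i U *m (col i V)^T).
Proof.
apply/matrixP => i j; rewrite mul_mx_diag !mxE summxE; apply: eq_bigr => l _.
by rewrite !mxE big_ord1 !mxE mulrAC mulrC mulrA.
Qed.

Lemma svd_partial_sumE n1 n2 k (U : 'M[R]_n1) s (V : 'M_(n2, n1)) :
  svd_partial_sum k U s V =
  U *m diag_mx (\row_i (if (i < k)%N then s 0 i else 0)) *m V^T.
Proof.
rewrite mulmx_diag_sum /svd_partial_sum big_mkcond; apply: eq_bigr => i _.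
by rewrite mxE; case: ifP => // _; rewrite scale0r.
Qed.

Lemma svd_partial_sum_full n1 n2 (U : 'M[R]_n1) s (V : 'M_(n2, n1)) :
  svd_partial_sum n1 U s V = U *m diag_mx s *m V^T.
Proof.
rewrite svd_partial_sumE; congr (_ *m diag_mx _ *m _).
by apply/rowP => i; rewrite mxE ltn_ord.
Qed.

Lemma is_svdP n1 n2 (X : 'M[R]_(n1, n2)) U s V : is_svd X U s V <->
  unsorted_svd X U s V /\ forall i j : 'I_n1, (i <= j)%N -> s 0 j <= s 0 i.
Proof.
rewrite /is_svd /unsorted_svd svd_partial_sum_full.
by split=> [[h1 h2 h3 h4 h5]|[[h1 h2 h3 h4] h5]].
Qed.

Lemma sorting_perm n (s : 'rV[R]_n) :
  exists p : 'S_n, forall i j : 'I_n, (i <= j)%N -> s 0 (p j) <= s 0 (p i).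
Proof.
pose r (i j : 'I_n) := s 0 j <= s 0 i; pose l := sort r (enum 'I_n).
have sl : size l = n by rewrite size_sort size_enum_ord.
have ul : uniq l by rewrite sort_uniq enum_uniq.
have rt : transitive r by move=> x y z h1 h2; exact: le_trans h2 h1.
have rr : reflexive r by move=> x; exact: lexx.
have rtot : total r by move=> x y; exact: le_total.
have inj : injective (fun i : 'I_n => nth i l i).
  move=> i j; rewrite (set_nth_default i j) ?sl// => /eqP.
  by rewrite nth_uniq ?sl// => /eqP; exact: val_inj.
exists (perm inj) => i j ij; rewrite !permE (set_nth_default i j) ?sl//.
by apply: (sorted_leq_nth rt rr) => //; rewrite ?inE ?sl ?sort_sorted.
Qed.

Lemma sort_svd n1 n2 (X : 'M[R]_(n1, n2)) U s V : unsorted_svd X U s V ->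
  exists p : 'S_n1, is_svd X (col_perm p U) (col_perm p s) (col_perm p V).
Proof.
move=> [UU VV s0 XE]; have [p sp] := sorting_perm s; exists p; apply/is_svdP.
have orth n (W : 'M[R]_(n, n1)) :
    W^T *m W = 1%:M -> (col_perm p W)^T *m col_perm p W = 1%:M.
  move=> h; apply/matrixP => i j; move/matrixP/(_ (p i) (p j)): h; rewrite !mxE.
  rewrite (inj_eq perm_inj) => <-; apply: eq_bigr => l _; by rewrite !mxE.
split; last by move=> i j ij; rewrite !mxE; exact: sp.
split; rewrite ?orth//; first by move=> i; rewrite mxE.
rewrite XE !mulmx_diag_sum (reindex_inj (@perm_inj _ p)) /=.
apply: eq_bigr => i _; rewrite mxE; congr (_ *: (_ *m _^T));
  by apply/colP => l; rewrite !mxE.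
Qed.

(** Dimension count: j linear conditions cannot cut a space of dimension greater
    than j down to 0. *)
Lemma meet_ker p N q (W : 'M[R]_(p, N)) (K : 'M[R]_(N, q)) j : (j < \rank W)%N ->
  exists w : 'rV_N, [/\ (w <= W)%MS, w != 0 &
    forall i : 'I_q, (i < j)%N -> (w *m K) 0 i = 0].
Proof.
move=> jW; pose M : 'M_(\rank W, q) := row_base W *m K *m pid_mx j.
have rM : (\rank M <= j)%N.
  apply: (leq_trans (mxrankM_maxr _ _)); have [jq|qj] := leqP j q.
    by rewrite rank_pid_mx.
  by rewrite (leq_trans (rank_leq_row _))// ltnW.
have : kermx M != 0.
  by rewrite kermx_eq0 /row_free neq_ltn (leq_ltn_trans rM).
case/rowV0Pn => y /sub_kermxP yM y0.
exists (y *m row_base W); split.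
- by rewrite (submx_trans (submxMl _ _))// eq_row_base.
- by rewrite mulmx_free_eq0 ?row_base_free.
- move=> i ij; move/rowP/(_ i): yM; rewrite /M !mulmxA mxE (bigD1 i)//= big1 => [|l li].
    by rewrite addr0 !mxE eqxx ij mulr1.
  by rewrite !mxE -[l == i :> nat]/(l == i) (negPf li) mulr0.
Qed.

(** The easy half of the Courant-Fischer principle: a space of dimension
    greater than j meets the orthogonal complement of the first j right
    singular vectors, and there X^T stretches by at most s_j. *)
Lemma singular_value_ge n1 n2 (X : 'M[R]_(n1, n2)) U s V p (W : 'M_(p, n2))
    (j : 'I_n1) mu : is_svd X U s V -> (j < \rank W)%N ->
  (forall w : 'rV_n2, (w <= W)%MS ->
     0 <= mu -> mu ^+ 2 * '[w, w] <= '[w *m X^T, w *m X^T]) ->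
  mu <= s 0 j.
Proof.
move=> /is_svdP[[UU VV s0 XE] srt] jW h.
have [m0|m0] := leP 0 mu; last exact: le_trans (ltW m0) (s0 j).
have [w [wW w0 wK]] := meet_ker V jW.
have wX : '[w *m X^T, w *m X^T] <= s 0 j ^+ 2 * '[w, w].
  rewrite XE !trmx_mul trmxK tr_diag_mx !mulmxA mxdot_isometry//.
  apply: (@le_trans _ _ (s 0 j ^+ 2 * '[w *m V, w *m V])); last first.
    by rewrite ler_wpM2l ?sqr_ge0 ?bessel.
  rewrite !mxdot_rV mulr_sumr; apply: ler_sum => l _.
  rewrite mul_mx_diag mxE -!expr2 exprMn mulrC.
  have [lj|jl] := ltnP l j; first by rewrite wK// expr0n !mulr0.
  by rewrite ler_wpM2r ?sqr_ge0// lerXn2r ?nnegrE ?s0// srt.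
have := le_trans (h w wW m0) wX; rewrite ler_pM2r ?mxdot_gt0//.
by rewrite ler_sqr ?nnegrE ?s0.
Qed.

Lemma rank_orthonormal_rows n q (K : 'M[R]_(n, q)) (c : R) j : c != 0 ->
  K^T *m K = c%:M -> (j <= q)%N -> \rank ((pid_mx j : 'M_q) *m K^T) = j.
Proof.
move=> c0 KK jq; rewrite mxrankMfree ?rank_pid_mx//.
apply/row_freeP; exists (c^-1 *: K); rewrite -scalemxAr KK.
by rewrite scale_scalar_mx mulVf.
Qed.

Lemma pid_row_support q j (z : 'rV[R]_q) (l : 'I_q) :
  (j <= l)%N -> (z *m (pid_mx j : 'M_q)) 0 l = 0.
Proof.
move=> jl; rewrite mxE big1 // => i _.
by rewrite mxE; case: eqP => [->|]; rewrite ?mulr0// ltnNge jl mulr0.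
Qed.

Lemma singular_values_le n1 n2 (X : 'M[R]_(n1, n2)) U s V U' s' V' (j : 'I_n1) :
  is_svd X U s V -> is_svd X U' s' V' -> s' 0 j <= s 0 j.
Proof.
move=> h /is_svdP[[UU VV s0 XE] srt].
apply: (singular_value_ge (W := (pid_mx j.+1 : 'M_n1) *m V'^T) h).
  by rewrite (@rank_orthonormal_rows _ _ _ 1) ?oner_eq0.
move=> w /submxP[y ->] _; rewrite XE !trmx_mul trmxK tr_diag_mx !mulmxA.
set z := y *m _; rewrite -[z *m V'^T *m V']mulmxA VV mulmx1.
rewrite !mxdot_isometry// !mxdot_rV mulr_sumr; apply: ler_sum => l _.
have -> : (z *m diag_mx s') 0 l = z 0 l * s' 0 l by rewrite mul_mx_diag mxE.
rewrite -!expr2 exprMn mulrC.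
have [lj|jl] := leqP l j; last by rewrite pid_row_support// expr0n !mul0r.
by rewrite ler_wpM2l ?sqr_ge0// lerXn2r ?nnegrE ?s0// srt.
Qed.

(** Singular values are defined by a choice among decompositions; this and the next
    lemma make every decomposition usable. *)
Lemma singular_valuesE n1 n2 (X : 'M[R]_(n1, n2)) U s V :
  is_svd X U s V -> singular_values X = s.
Proof.
move=> h; rewrite /singular_values; case: xgetP => [s' _ [U' [V' h']]|].
  apply/rowP => j; apply/eqP.
  by rewrite eq_le (singular_values_le _ h h') (singular_values_le _ h' h).
by move/(_ s) => /=; case; exists U, V.
Qed.

Lemma nuclear_normE n1 n2 (X : 'M[R]_(n1, n2)) U s V :
  unsorted_svd X U s V -> nuclear_norm X = \sum_i s 0 i.
Proof.
move=> /sort_svd[p /singular_valuesE e]; rewrite /nuclear_norm e.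
by rewrite [RHS](reindex_inj (@perm_inj _ p)); apply: eq_bigr => i _; rewrite mxE.
Qed.

Lemma svd_exists n1 n2 (X : 'M[R]_(n1, n2)) : (n1 <= n2)%N ->
  exists U s V, is_svd X U s V.
Proof.
move=> n12; have [U [s [V /sort_svd[p h]]]] := unsorted_svd_exists X n12.
by exists (col_perm p U), (col_perm p s), (col_perm p V).
Qed.

End SingularValues.

(** * Mirsky's inequality for the nuclear norm *)

Section Mirsky.
Variable R : realType.

Lemma mxdot_rows m n (A B : 'M[R]_(m, n)) : '[A, B] = \sum_i '[row i A, row i B].
Proof.
rewrite mxdotE; apply: eq_bigr => i _; rewrite mxdot_rV.
by apply: eq_bigr => j _; rewrite !mxE.
Qed.

(** By Cauchy-Schwarz a lower bound on the quadratic form is one on the length of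
    the image. *)
Lemma singular_value_form_ge N (M : 'M[R]_N) U s V p (W : 'M_(p, N)) (j : 'I_N) mu :
  is_svd M U s V -> M^T = M -> (j < \rank W)%N ->
  (forall w : 'rV_N, (w <= W)%MS -> mu * '[w, w] <= '[w *m M, w]) ->
  mu <= s 0 j.
Proof.
move=> h Mt jW hW; apply: (singular_value_ge h jW) => w wW mu0; rewrite Mt.
have [->|w0] := eqVneq w 0; first by rewrite mul0mx mxdot0l mulr0.
have wp := mxdot_gt0 w0; rewrite -(ler_pM2r wp).
apply: le_trans (mxdot_CS _ _); rewrite -mulrA -expr2 -exprMn.
have l0 : 0 <= mu * '[w, w] by rewrite mulr_ge0// ltW.
by rewrite ler_sqr ?nnegrE ?(le_trans l0)// hW.
Qed.

(** For a positive semidefinite form, 2 u M v <= u M u + v M v; summed over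
    pairs of singular vectors the right-hand side is twice the trace. *)
Lemma sum_singular_values_psd N (M : 'M[R]_N) U s V :
  is_svd M U s V -> M^T = M -> (forall w : 'rV_N, 0 <= '[w *m M, w]) ->
  \sum_i s 0 i <= \tr M.
Proof.
move=> /is_svdP[[UU VV _ ME] _] Mt psd.
have UU' := mulmx1C UU; have VV' := mulmx1C VV.
have psdA : 0 <= '[(U - V)^T *m M, (U - V)^T].
  by rewrite mxdot_rows; apply: sumr_ge0 => i _; rewrite row_mul.
have trE (A B : 'M[R]_N) : '[A^T *m M, B^T] = \tr (M *m (B *m A^T)).
  by rewrite /mxdot trmxK -mulmxA mxtrace_mulC mulmxA.
have e : '[U^T *m M, V^T] = \sum_i s 0 i.
  by rewrite /mxdot trmxK ME !mulmxA UU mul1mx -mulmxA VV mulmx1 mxtrace_diag.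
have e' : '[V^T *m M, U^T] = \sum_i s 0 i.
  by rewrite mxdot_mulr Mt mxdotC e.
have eU : '[U^T *m M, U^T] = \tr M by rewrite trE UU' mulmx1.
have eV : '[V^T *m M, V^T] = \tr M by rewrite trE VV' mulmx1.
move: psdA; rewrite (_ : (U - V)^T = U^T - V^T); last first.
  by apply/matrixP => i j; rewrite !mxE.
rewrite mulmxBl mxdotDl !mxdotDr !mxdotNl !mxdotNr e e' eU eV.
by move=> k; lra.
Qed.

(** The symmetric matrix whose nonzero eigenvalues are the singular values of Y and
    their opposites. *)
Definition dilation n1 n2 (Y : 'M[R]_(n1, n2)) : 'M_(n1 + n2) :=
  block_mx 0 Y Y^T 0.

Lemma dilation_form n1 n2 (Y : 'M[R]_(n1, n2)) U s V (x : 'rV_n1) (y : 'rV_n2) :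
  unsorted_svd Y U s V ->
  '[row_mx x y *m dilation Y, row_mx x y] =
  2 * \sum_i s 0 i * ((x *m U) 0 i * (y *m V) 0 i).
Proof.
move=> [_ _ _ YE]; rewrite /dilation mul_row_block !mulmx0 add0r addr0 mxdot_row_mx.
rewrite mxdot_mulr trmxK mxdotC -mulr2n -[LHS]mulr_natl; congr (_ * _).
rewrite YE !mulmxA mxdot_mulr trmxK mxdot_rV; apply: eq_bigr => i _.
by rewrite mul_mx_diag mxE mulrAC mulrC.
Qed.

(** With p = x U and q = y V the form is the sum of 2 s_i p_i q_i. Coordinates where
    p_i = q_i contribute nonnegative terms; the others cost at most mu, by
    2 p q >= - (p^2 + q^2) and Bessel's inequality. *)
Lemma dilation_form_ge n1 n2 (Y : 'M[R]_(n1, n2)) U s V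
    (x : 'rV_n1) (y : 'rV_n2) mu (l : nat) :
  unsorted_svd Y U s V -> 0 <= mu ->
  (forall i : 'I_n1, (l <= i)%N -> s 0 i <= mu) ->
  (forall i : 'I_n1, (i < l)%N -> (x *m U) 0 i = (y *m V) 0 i) ->
  - mu * '[row_mx x y, row_mx x y] <= '[row_mx x y *m dilation Y, row_mx x y].
Proof.
move=> h mu0 smu xy; rewrite (dilation_form _ _ h) mxdot_row_mx.
case: h => UU VV s0 _.
have hx := bessel x UU; have hy := bessel y VV.
apply: (@le_trans _ _ (- mu * ('[x *m U, x *m U] + '[y *m V, y *m V]))).
  by rewrite !mulNr lerN2 ler_wpM2l// lerD.
rewrite !mxdot_rV -big_split/= !mulr_sumr; apply: ler_sum => i _.
have [li|il] := leqP l i.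
  have := smu i li; have := s0 i; move: (s 0 i) ((x *m U) 0 i) ((y *m V) 0 i).
  move=> a b c a0 am; have q := sqr_ge0 (b + c); have p : 0 <= b * b + c * c.
    by rewrite addr_ge0// -expr2 sqr_ge0.
  have : 0 <= (mu - a) * (b * b + c * c) by rewrite mulr_ge0 ?subr_ge0.
  have : 0 <= a * (b + c) ^+ 2 by rewrite mulr_ge0.
  by rewrite expr2 => h1 h2; lra.
rewrite xy//; set b := (y *m V) 0 i; have p : 0 <= b * b by rewrite -expr2 sqr_ge0.
have : 0 <= s 0 i * (b * b) by rewrite mulr_ge0.
have : 0 <= mu * (b * b) by rewrite mulr_ge0.
by move=> h1 h2; lra.
Qed.

Section Dominated.
Variables (n1 n2 : nat) (Y : 'M[R]_(n1, n2)) (U : 'M[R]_n1) (s : 'rV[R]_n1)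
  (V : 'M[R]_(n2, n1)) (M : 'M[R]_(n1 + n2)) (c : R).
Variables (U' V' : 'M[R]_(n1 + n2)) (s' : 'rV[R]_(n1 + n2)).
Hypotheses (svdY : is_svd Y U s V) (Mt : M^T = M).
Hypothesis dom : forall w : 'rV_(n1 + n2), '[w *m dilation Y, w] <= '[w *m M, w].
Hypothesis svdM : is_svd (M + c%:M) U' s' V'.

Let McT : (M + c%:M)^T = M + c%:M.
Proof. by rewrite linearD/= Mt tr_scalar_mx. Qed.

Let formMc (w : 'rV_(n1 + n2)) :
  '[w *m (M + c%:M), w] = '[w *m M, w] + c * '[w, w].
Proof. by rewrite mulmxDr mul_mx_scalar mxdotDl mxdotZl. Qed.

(** The test space is spanned by the eigenvectors (a_l, c_l), l <= j, of the
    dilation, where a_l and c_l are the singular vectors. *)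
Lemma dominated_top (j : 'I_n1) : s 0 j + c <= s' 0 (lshift n2 j).
Proof.
have /is_svdP[uY srt] := svdY; have [UU VV s0 YE] := uY.
pose K := col_mx U V.
have KK : K^T *m K = 2%:M.
  by rewrite tr_col_mx mul_row_col UU VV -raddfD/=.
apply: (singular_value_form_ge (W := (pid_mx j.+1 : 'M_n1) *m K^T) svdM McT).
  by rewrite (rank_orthonormal_rows _ KK)// pnatr_eq0.
move=> w /submxP[y ->]; rewrite formMc mulrDl lerD2r.
apply: le_trans (dom _); rewrite mulmxA tr_col_mx.
have [z zE] : exists z, z = y *m (pid_mx j.+1 : 'M_n1) by eexists.
rewrite -zE mul_mx_row (dilation_form _ _ uY) mxdot_row_mx.
rewrite -!(mulmxA z) UU VV mulmx1 !mxdot_isometry// mulrDr -mulr2n -[leLHS]mulr_natl.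
rewrite ler_pM2l ?ltr0n// mxdot_rV mulr_sumr; apply: ler_sum => l _.
rewrite -expr2; have [lj|jl] := leqP l j.
  by rewrite ler_wpM2r ?sqr_ge0// srt.
by rewrite zE pid_row_support// expr0n !mulr0.
Qed.

(** The test space is orthogonal to the eigenvectors (a_i, - c_i), i < l, of the
    dilation. The bound mu stands for the l-th singular value, which does not exist
    for l >= n1: there mu = 0 is possible. *)
Lemma dominated_bottom (l : 'I_n2) mu : 0 <= mu ->
  (forall i : 'I_n1, (l <= i)%N -> s 0 i <= mu) ->
  c - mu <= s' 0 (rshift n1 (rev_ord l)).
Proof.
move=> mu0 smu; have /is_svdP[uY srt] := svdY.
pose L : 'M_(n1 + n2, n1) := col_mx U (- V).
pose W := kermx (L *m (pid_mx l : 'M_n1)).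
apply: (singular_value_form_ge (W := W) svdM McT).
  rewrite mxrank_ker /=.
  have : (\rank (L *m (pid_mx l : 'M_n1)) <= l)%N.
    apply: leq_trans (mxrankM_maxr _ _) _; have [lq|ql] := leqP l n1.
      by rewrite rank_pid_mx.
    by rewrite (leq_trans (rank_leq_row _))// ltnW.
  by have := ltn_ord l; lia.
move=> w /sub_kermxP wL; rewrite formMc mulrDl [leRHS]addrC lerD2l.
apply: le_trans (dom _); rewrite -(hsubmxK w).
apply: (dilation_form_ge uY mu0 smu) => i il.
move/rowP/(_ i): wL; rewrite mulmxA mxE (bigD1 i)//= big1 => [|k ki].
  have wLE : w *m L = lsubmx w *m U - rsubmx w *m V.
    by rewrite -{1}(hsubmxK w) mul_row_col mulmxN.
  have subE (A B : 'rV[R]_n1) : (A - B) 0 i = A 0 i - B 0 i by rewrite !mxE.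
  rewrite addr0 [X in _ * X]mxE eqxx il mulr1 wLE subE.
  by rewrite [(0 : matrix _ _ _) _ _]mxE => /eqP; rewrite subr_eq0 => /eqP.
by rewrite [X in _ * X]mxE -[k == i :> nat]/(k == i) (negPf ki) mulr0.
Qed.

End Dominated.


(** Both dilations are dominated by M = dilation Z + positive part of
    dilation (Y - Z), whose trace is the nuclear norm of Y - Z. Each eigenvalue of M
    is therefore at least the larger of the two corresponding eigenvalues of
    dilation Y and dilation Z; these maxima are max (s1 i) (s2 i), - min (s1 i) (s2 i)
    and zeros, and adding them up gives the inequality. M is shifted by c to be
    positive semidefinite, so that its eigenvalues are its singular values. *)
Theorem mirsky_nuclear n1 n2 (Y Z : 'M[R]_(n1, n2)) U1 s1 V1 U2 s2 V2 :
  (n1 <= n2)%N -> is_svd Y U1 s1 V1 -> is_svd Z U2 s2 V2 ->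
  \sum_i `|s1 0 i - s2 0 i| <= nuclear_norm (Y - Z).
Proof.
move=> n12 svdY svdZ.
have [/is_svdP[uY srtY] /is_svdP[uZ srtZ]] := (svdY, svdZ).
have [Uc [g [Vc uC]]] := unsorted_svd_exists (Y - Z) n12.
rewrite (nuclear_normE uC); case: uC => UU VV g0 YZ.
pose P (Q : 'M[R]_(n1 + n2, n1)) := 2^-1 *: (Q *m diag_mx g *m Q^T).
pose K := col_mx Uc Vc; pose L := col_mx Uc (- Vc).
have Pt Q : (P Q)^T = P Q.
  by rewrite /P linearZ/= !trmx_mul trmxK tr_diag_mx mulmxA.
have Pge Q (w : 'rV_(n1 + n2)) : 0 <= '[w *m P Q, w].
  rewrite -scalemxAr mxdotZl mulr_ge0 ?invr_ge0// !mulmxA mxdot_mulr trmxK mxdot_rV.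
  apply: sumr_ge0 => i _; rewrite mul_mx_diag mxE mulrAC mulr_ge0//.
  by rewrite -expr2 sqr_ge0.
pose M := dilation Z + P K.
have dil_t (X : 'M[R]_(n1, n2)) : (dilation X)^T = dilation X.
  by rewrite /dilation tr_block_mx !trmx0 trmxK.
(* L diag(g) L^T / 2 is the negative part of dilation (Y - Z) *)
have ME : M = dilation Y + P L.
  rewrite /M /P /dilation (_ : Y = Z + (Y - Z)); last by rewrite addrC subrK.
  rewrite YZ /K /L !tr_col_mx !(mul_col_mx _ _ (diag_mx g)) !mul_col_row.
  rewrite !scale_block_mx !add_block_mx raddfD/= raddfN/= !(mulNmx, mulmxN) opprK.
  have half (p q : nat) (A : 'M[R]_(p, q)) : 2^-1 *: A = A - 2^-1 *: A.
    by rewrite -[X in X - _]scale1r -scalerBl; congr (_ *: _); field.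
  rewrite !trmx_mul trmxK tr_diag_mx !mulmxA !scalerN -!addrA -!half.
  by [].
have Mt : M^T = M by rewrite linearD/= dil_t Pt.
have domZ (w : 'rV_(n1 + n2)) : '[w *m dilation Z, w] <= '[w *m M, w].
  by rewrite /M mulmxDr mxdotDl lerDl Pge.
have domY (w : 'rV_(n1 + n2)) : '[w *m dilation Y, w] <= '[w *m M, w].
  by rewrite ME mulmxDr mxdotDl lerDl Pge.
pose c := \sum_i s1 0 i.
have c0 : 0 <= c by apply: sumr_ge0 => i _; case: uY.
have psd (w : 'rV_(n1 + n2)) : 0 <= '[w *m (M + c%:M), w].
  rewrite mulmxDr mul_mx_scalar mxdotDl mxdotZl -[c]opprK mulNr subr_ge0.
  apply: le_trans (domY _); rewrite -(hsubmxK w).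
  apply: (@dilation_form_ge _ _ _ _ _ _ _ _ _ 0 uY) => // i _.
  by rewrite /c (bigD1 i)//= lerDl; apply: sumr_ge0 => k _; case: uY.
have [U' [s' [V' svdM]]] := svd_exists (M + c%:M) (leqnn _).
have trM : \tr (M + c%:M) = \sum_i g 0 i + c *+ (n1 + n2).
  rewrite mxtraceD mxtrace_scalar; congr (_ + _).
  rewrite mxtraceD /dilation mxtrace_block !mxtrace0 !add0r /P mxtraceZ.
  rewrite mxtrace_mulC mulmxA tr_col_mx mul_row_col UU VV -raddfD/= mul_scalar_mx.
  by rewrite mxtraceZ mxtrace_diag; field.
have Mct : (M + c%:M)^T = M + c%:M by rewrite linearD/= Mt tr_scalar_mx.
have := sum_singular_values_psd svdM Mct psd.
rewrite trM big_split_ord/=.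
pose hi i := Num.max (s1 0 i) (s2 0 i); pose lo i := Num.min (s1 0 i) (s2 0 i).
have top : \sum_i hi i + c *+ n1 <= \sum_(i < n1) s' 0 (lshift n2 i).
  rewrite -[X in c *+ X]card_ord -sumr_const -big_split/=; apply: ler_sum => i _.
  rewrite /hi; case: (leP (s1 0 i)) => _.
    exact: (dominated_top svdZ Mt domZ svdM).
  exact: (dominated_top svdY Mt domY svdM).
pose lo' (l : nat) := if insub l is Some i then lo i else 0.
have bot : c *+ n2 - \sum_(l < n2) lo' l <= \sum_(i < n2) s' 0 (rshift n1 i).
  rewrite [leRHS](reindex_inj rev_ord_inj)/= -[X in c *+ X]card_ord -sumr_const.
  rewrite -sumrB; apply: ler_sum => l _; rewrite /lo'.
  case: insubP => [i _ /= il|]; last first.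
    rewrite -leqNgt => nl.
    apply: (dominated_bottom svdY Mt domY svdM) => // i li.
    by have := leq_trans nl li; rewrite leqNgt ltn_ord.
  rewrite /lo; case: (leP (s1 0 i)) => _.
    apply: (dominated_bottom svdY Mt domY svdM); first by case: uY.
    by move=> k lk; apply: srtY; rewrite il.
  apply: (dominated_bottom svdZ Mt domZ svdM); first by case: uZ.
  by move=> k lk; apply: srtZ; rewrite il.
have sum_lo : \sum_(l < n2) lo' l = \sum_i lo i.
  rewrite -(big_mkord xpredT lo') (big_cat_nat (leq0n n1) n12)//= big_mkord.
  rewrite [X in _ + X]big_nat.
  rewrite [X in _ + X]big1 ?addr0 => [|l /andP[l1 _]]; last first.
    by rewrite /lo' insubN// -leqNgt.
  by apply: eq_bigr => l _; rewrite /lo' valK.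
rewrite sum_lo in bot.
have -> : \sum_i `|s1 0 i - s2 0 i| = \sum_i hi i - \sum_i lo i.
  rewrite -sumrB; apply: eq_bigr => i _; rewrite /hi /lo.
  case: (leP (s1 0 i)) => h; first by rewrite ler0_norm ?opprB// subr_le0.
  by rewrite gtr0_norm// subr_gt0.
rewrite mulrnDr => h; lra.
Qed.

End Mirsky.

(** * Averages over subsets and sparse extreme points *)

Section SparseRIP.
Variable R : realType.

(** Every element survives in the same number of the subsets obtained by deleting
    one element, so the sum over T is an average of sums over smaller sets. *)
Lemma sum_le0_of_subsets (I : finType) (a : nat) (f : I -> R) (T : {set I}) :
  (0 < a <= #|T|)%N ->
  (forall S : {set I}, S \subset T -> #|S| = a -> \sum_(i in S) f i <= 0) ->
  \sum_(i in T) f i <= 0.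
Proof.
case/andP => a0; have [m] := ubnP #|T|; elim: m T => // m IH T mT aT h.
have [aE|aT'] := eqVneq a #|T|; first exact: h.
have {}aT : (a < #|T|)%N by rewrite ltn_neqAle aT'.
have s i : i \in T -> \sum_(j in T) f j - f i <= 0.
  move=> iT; rewrite (big_setD1 i)//= addrC addrK.
  have cD := cardsD1 i T; rewrite iT add1n in cD.
  apply: IH; [by rewrite -ltnS -cD|by rewrite -ltnS -cD|].
  by move=> S ST; apply: h; rewrite (subset_trans ST)// subD1set.
have : \sum_(i in T) (\sum_(j in T) f j - f i) <= 0 by apply: sumr_le0.
rewrite sumrB sumr_const -[X in _ - X]mulr1n -mulrnBr ?pmulrn_lle0 ?subn_gt0//.
  exact: leq_ltn_trans a0 aT.
exact: leq_trans a0 (ltnW aT).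
Qed.

(** Averaging and Jensen's inequality for the square root. Jensen's inequality enters
    by linearizing the square root at q, its value on a subset carrying the average
    share a / #|T| of the energy. *)
Lemma sum_le_of_subsets (I : finType) (a : nat) (l h : I -> R) c (T : {set I}) :
  (0 < a <= #|T|)%N -> 0 <= c ->
  (forall S : {set I}, S \subset T -> #|S| = a ->
     \sum_(i in S) l i <= c * Num.sqrt (\sum_(i in S) h i ^+ 2)) ->
  \sum_(i in T) l i <=
    c * Num.sqrt (#|T|%:R / a%:R) * Num.sqrt (\sum_(i in T) h i ^+ 2).
Proof.
move=> aT c0 hS; have /andP[a0 aT'] := aT.
have a0R : 0 < a%:R :> R by rewrite ltr0n.
have T0R : 0 < #|T|%:R :> R by rewrite ltr0n (leq_trans a0).
set E := \sum_(i in T) h i ^+ 2; have E0 : 0 <= E by apply: sumr_ge0 => i _; exact: sqr_ge0.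
have [EZ|Ep] := eqVneq E 0.
  rewrite EZ sqrtr0 mulr0; apply: (sum_le0_of_subsets aT) => S ST Sa.
  apply: le_trans (hS S ST Sa) _; rewrite (_ : \sum_(i in S) _ = 0) ?sqrtr0 ?mulr0//.
  apply/eqP; rewrite eq_le; apply/andP; split; last by apply: sumr_ge0 => i _; exact: sqr_ge0.
  apply: (@le_trans _ _ E); last by rewrite EZ.
  rewrite /E [leRHS](big_setID S)/= (setIidPr ST) lerDl.
  by apply: sumr_ge0 => i _; exact: sqr_ge0.
have {}E0 : 0 < E by rewrite lt0r Ep.
have [q [q0 q2]] : exists q : R, 0 < q /\ q ^+ 2 = E * a%:R / #|T|%:R.
  exists (Num.sqrt (E * a%:R / #|T|%:R)).
  by rewrite sqrtr_gt0 sqr_sqrtr ?ltW// divr_gt0// mulr_gt0.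
have key : \sum_(i in T) (l i - c * (h i ^+ 2 / (2 * q) + q / (2 * a%:R))) <= 0.
  apply: (sum_le0_of_subsets aT) => S ST Sa.
  rewrite sumrB subr_le0; apply: le_trans (hS S ST Sa) _.
  rewrite -mulr_sumr ler_wpM2l// big_split/= -mulr_suml sumr_const Sa.
  set e := \sum_(i in S) h i ^+ 2; have e0 : 0 <= e by apply: sumr_ge0 => i _; exact: sqr_ge0.
  have -> : q / (2 * a%:R) *+ a = q / 2 by rewrite -mulr_natr; field; rewrite gt_eqF.
  rewrite -{2}(sqr_sqrtr e0); move: (Num.sqrt e) => y.
  rewrite -(@ler_pM2r _ (2 * q)) ?mulr_gt0//.
  rewrite [leRHS](_ : _ = y ^+ 2 + q ^+ 2); last by field; rewrite gt_eqF.
  by have := sqr_ge0 (y - q); nra.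
move: key; rewrite sumrB subr_le0 => /le_trans; apply.
rewrite -mulr_sumr -mulrA ler_wpM2l// big_split/= -mulr_suml sumr_const -/E.
have EE : E = q ^+ 2 * (#|T|%:R / a%:R) by rewrite q2; field; rewrite !gt_eqF.
have g0 : 0 <= #|T|%:R / a%:R :> R by rewrite divr_ge0// ltW.
have -> : Num.sqrt E = q * Num.sqrt (#|T|%:R / a%:R).
  by rewrite EE sqrtrM ?sqr_ge0// sqrtr_sqr gtr0_norm.
rewrite mulrCA -expr2 sqr_sqrtr// EE -mulr_natr le_eqVlt; apply/orP; left; apply/eqP.
by field; rewrite !gt_eqF.
Qed.

Lemma top_subset (I : finType) (f : I -> R) (P : {set I}) b : (b <= #|P|)%N ->
  exists (S : {set I}) (c : R), [/\ S \subset P, #|S| = b,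
    forall i, i \in S -> c <= f i &
    forall j, j \in P :\: S -> f j <= c].
Proof.
elim: b => [_|b IH bP].
  exists set0, (\sum_(j in P) `|f j|); split; rewrite ?sub0set ?cards0//.
    by move=> i; rewrite inE.
  move=> j; rewrite setD0 => jP; rewrite (bigD1 j)//=.
  by rewrite (le_trans (ler_norm _))// lerDl sumr_ge0.
have [S [c [SP Sb cS cP]]] := IH (ltnW bP).
have /card_gt0P[j0 j0P] : (0 < #|P :\: S|)%N by rewrite cardsDS// Sb subn_gt0.
case: (arg_maxP f j0P) => j jP0 jmax; have jP : j \in P :\: S := jP0.
exists (j |: S), (f j); split.
- by rewrite subUset SP andbT sub1set; move: jP; rewrite inE => /andP[].
- by rewrite cardsU1 Sb; move: jP; rewrite inE => /andP[-> _].
- by move=> i; rewrite !inE => /orP[/eqP->//|/cS ci]; exact: le_trans (cP _ jP) ci.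
- move=> i; rewrite !inE negb_or -andbA => /and3P[_ iS iP].
  by apply: jmax; apply/setDP; split.
Qed.

(** Linear programming over the polytope of vectors v with entries between 0 and alpha
    and sum at most b alpha, whose relevant extreme points are b-sparse. The threshold
    c' between the b largest values of f and the others is the dual solution. *)
Lemma sparse_polytope_bound (I : finType) (v f : I -> R) (P : {set I}) b alpha :
  0 <= alpha -> (forall i, 0 <= f i) ->
  (forall i, i \in P -> 0 <= v i <= alpha) ->
  \sum_(i in P) v i <= b%:R * alpha ->
  exists S : {set I}, [/\ S \subset P, (#|S| <= b)%N &
    \sum_(i in P) v i * f i <= alpha * \sum_(i in S) f i].
Proof.
move=> al0 f0 va sv; have [bP|Pb] := leqP b #|P|; last first.
  exists P; split=> //; first exact: ltnW.
  by rewrite mulr_sumr; apply: ler_sum => i /va/andP[_ h]; rewrite ler_wpM2r.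
have [S [c [SP Sb cS cP]]] := top_subset f bP.
exists S; split; rewrite ?Sb//.
pose c' := Num.max c 0; have c'0 : 0 <= c' by rewrite le_max lexx orbT.
have c'S i : i \in S -> c' <= f i by move=> /cS ci; rewrite ge_max ci f0.
have c'P j : j \in P :\: S -> f j <= c' by move=> /cP ci; rewrite le_max ci.
have split_P (g : I -> R) : \sum_(i in P) g i = \sum_(i in S) g i + \sum_(i in P :\: S) g i.
  by rewrite (big_setID S)/= (setIidPr SP).
have h1 : \sum_(i in P) v i * (f i - c') <= alpha * \sum_(i in S) (f i - c').
  rewrite split_P -[leRHS]addr0; apply: lerD.
    rewrite mulr_sumr; apply: ler_sum => i iS; rewrite ler_wpM2r ?subr_ge0 ?c'S//.
    by case/andP: (va i (subsetP SP i iS)).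
  apply: sumr_le0 => i iPS; rewrite mulr_ge0_le0// ?subr_le0 ?c'P//.
  by move: iPS; rewrite inE => /andP[_ /va/andP[]].
have : c' * \sum_(i in P) v i <= c' * (b%:R * alpha) by rewrite ler_wpM2l.
move: h1; under eq_bigr do rewrite mulrBr.
rewrite sumrB -mulr_suml sumrB sumr_const Sb -mulr_natl => h1 h2.
by lra.
Qed.

End SparseRIP.

(** * Sparse restricted isometry and Gram matrices *)

Section GramRIP.
Variables (R : realType) (m n : nat) (z : 'I_n -> 'cV[R]_m).
Implicit Types (S T P : {set 'I_n}) (x y v : 'I_n -> R).

Definition lincomb S x : 'cV[R]_m := \sum_(i in S) x i *: z i.
Definition energy S x : R := \sum_(i in S) x i ^+ 2.

Lemma energy_ge0 S x : 0 <= energy S x.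
Proof. by apply: sumr_ge0 => i _; exact: sqr_ge0. Qed.

Lemma lincomb_dot S x (u : 'cV[R]_m) :
  '[lincomb S x, u] = \sum_(i in S) x i * '[z i, u].
Proof. by rewrite mxdot_suml; apply: eq_bigr => i _; rewrite mxdotZl. Qed.

Definition sparse_RIP r (delta : R) := forall S x, (#|S| <= r)%N ->
  (1 - delta) * energy S x <= '[lincomb S x, lincomb S x] <=
  (1 + delta) * energy S x.

Variables (r : nat) (delta : R).
Hypothesis rip : sparse_RIP r delta.
Hypothesis delta0 : 0 < delta.

Lemma disjoint_glue (V : zmodType) S P (F G : 'I_n -> V) : [disjoint S & P] ->
  \sum_(i in S :|: P) (if i \in S then F i else G i) =
  \sum_(i in S) F i + \sum_(i in P) G i.
Proof.
move=> SP; rewrite (eq_bigl (mem [predU S & P])) => [|i]; last by rewrite !inE.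
rewrite bigU//=; congr (_ + _); apply: eq_bigr => i iS; first by rewrite iS.
by rewrite (disjointFl SP iS).
Qed.

(** Compare the lower isometry bound at x + c y with the upper one at x - c y, for
    all real c. *)
Lemma sparse_near_orthogonal S P x y : [disjoint S & P] -> (#|S| + #|P| <= r)%N ->
  `|'[lincomb S x, lincomb P y]| <=
  delta * (Num.sqrt (energy S x) * Num.sqrt (energy P y)).
Proof.
move=> SP cr.
have dE : 0 <= delta * energy S x by rewrite mulr_ge0 ?energy_ge0// ltW.
rewrite -ler_sqr ?nnegrE ?mulr_ge0 ?sqrtr_ge0 ?(ltW delta0)//.
rewrite real_normK ?num_real// 2!exprMn !sqr_sqrtr ?energy_ge0//.
rewrite (_ : delta ^+ 2 * _ = (delta * energy S x) * (delta * energy P y)); last by ring.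
apply: discr_le0 => c.
pose w c i := if i \in S then x i else c * y i.
have cU : (#|S :|: P| <= r)%N.
  by rewrite (leq_trans _ cr)// cardsU leq_subr.
have Bw c' : lincomb (S :|: P) (w c') = lincomb S x + c' *: lincomb P y.
  rewrite /lincomb scaler_sumr -(disjoint_glue _ _ SP); apply: eq_bigr => i _.
  by rewrite /w scalerA; case: ifP.
have Ew c' : energy (S :|: P) (w c') = energy S x + c' ^+ 2 * energy P y.
  rewrite /energy mulr_sumr -(disjoint_glue _ _ SP); apply: eq_bigr => i _.
  by rewrite /w -exprMn; case: ifP.
have /andP[lo _] := rip (w c) cU; have /andP[_ hi] := rip (w (- c)) cU.
move: lo hi; rewrite !Bw !Ew !mxdotDl !mxdotDr !mxdotZl !mxdotZr sqrrN.
rewrite (mxdotC (lincomb P y)) => lo hi.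
move: (energy S x) (energy P y) ('[_, _]) ('[_, _]) ('[_, _]) lo hi => e1 e2 p q s.
by move=> lo hi; nra.
Qed.

Lemma dot_le_of_subsets a x (u : 'cV[R]_m) c T : (0 < a <= #|T|)%N -> 0 <= c ->
  (forall S, S \subset T -> #|S| = a ->
     '[lincomb S x, u] <= c * Num.sqrt (energy S x)) ->
  '[lincomb T x, u] <= c * Num.sqrt (#|T|%:R / a%:R) * Num.sqrt (energy T x).
Proof.
move=> aT c0 h; rewrite lincomb_dot; apply: (sum_le_of_subsets aT c0) => S ST Sa.
by rewrite -lincomb_dot h.
Qed.

Lemma lincomb_dot_upper x (u : 'cV[R]_m) T : (0 < r <= #|T|)%N ->
  '[lincomb T x, u] <=
  Num.sqrt (1 + delta) * Num.sqrt '[u, u] * Num.sqrt (#|T|%:R / r%:R) *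
  Num.sqrt (energy T x).
Proof.
move=> rT; apply: (dot_le_of_subsets rT); first by rewrite mulr_ge0 ?sqrtr_ge0.
move=> S _ Sr; have d1 : 0 <= 1 + delta by rewrite addr_ge0// ltW.
apply: le_trans (ler_norm _) _.
rewrite -ler_sqr ?nnegrE ?mulr_ge0 ?sqrtr_ge0// real_normK ?num_real//.
rewrite !exprMn !sqr_sqrtr ?energy_ge0 ?mxdot_ge0//.
apply: le_trans (mxdot_CS _ _) _; rewrite mulrAC ler_wpM2r ?mxdot_ge0//.
by have /andP[] := rip x (eq_leq Sr).
Qed.

(** The tail is replaced by the b-sparse sign vector at which
    the linear form given by the head is largest; near-orthogonality applies to it. *)
Lemma head_tail_ge a b x v T P alpha : [disjoint T & P] -> (0 < a <= #|T|)%N ->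
  (a + b <= r)%N -> 0 <= alpha -> (forall i, i \in P -> 0 <= v i <= alpha) ->
  \sum_(i in P) v i <= b%:R * alpha ->
  - '[lincomb T x, lincomb P v] <=
  delta * alpha * Num.sqrt b%:R * Num.sqrt (#|T|%:R / a%:R) * Num.sqrt (energy T x).
Proof.
move=> TP aT ab al0 va sv; rewrite -mxdotNr; apply: (dot_le_of_subsets aT).
  by rewrite !mulr_ge0 ?sqrtr_ge0// ltW.
move=> S ST Sa; pose f i := '[z i, lincomb S x].
have [Q [QP Qb h]] := sparse_polytope_bound al0 (fun i => normr_ge0 (f i)) va sv.
pose sg i := - Num.sg (f i).
have -> : '[lincomb S x, - lincomb P v] = \sum_(i in P) v i * (- f i).
  by rewrite mxdotNr mxdotC lincomb_dot -sumrN; apply: eq_bigr => i _; rewrite mulrN.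
apply: (@le_trans _ _ (\sum_(i in P) v i * `|f i|)).
  apply: ler_sum => i /va/andP[v0 _]; rewrite ler_wpM2l//.
  by rewrite -normrN ler_norm.
apply: le_trans h _.
have -> : \sum_(i in Q) `|f i| = - '[lincomb Q sg, lincomb S x].
  rewrite lincomb_dot -sumrN; apply: eq_bigr => i _.
  by rewrite /sg -/(f i) mulNr opprK normrEsg.
have SQ : [disjoint S & Q] by apply: disjointWl ST _; exact: disjointWr QP _.
have SQr : (#|S| + #|Q| <= r)%N by rewrite Sa (leq_trans _ ab)// leq_add2l.
have := sparse_near_orthogonal x sg SQ SQr; rewrite mxdotC ler_norml => /andP[g _].
have sQ : Num.sqrt (energy Q sg) <= Num.sqrt b%:R.
  rewrite ler_wsqrtr// (@le_trans _ _ (#|Q|%:R))// ?ler_nat//.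
  rewrite -sumr_const; apply: ler_sum => i _; rewrite /sg sqrrN sqr_sg.
  by case: (_ == _); rewrite ?ler01.
rewrite (_ : delta * alpha * _ * _ =
  alpha * (delta * (Num.sqrt (energy S x) * Num.sqrt b%:R))); last by ring.
rewrite ler_wpM2l// lerNl; apply: le_trans g.
by rewrite lerN2 ler_wpM2l ?(ltW delta0)// ler_wpM2l ?sqrtr_ge0.
Qed.

Definition diagonal S x : R := \sum_(i in S) x i ^+ 2 * '[z i, z i].

Lemma lincomb_D1 T x i : i \in T ->
  lincomb (T :\ i) x = lincomb T x - x i *: z i.
Proof. by move=> iT; rewrite /lincomb (big_setD1 i iT)/= addrC addrK. Qed.

(** The average of the lower isometry bounds over all r-subsets of T. Induction on the
    cardinal of T, deleting one index at a time, avoids counting subsets: a diagonal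
    term survives #|T| - 1 deletions and an off-diagonal one #|T| - 2. *)
Lemma gram_average T x : (1 < r)%N -> (r <= #|T|)%N ->
  (1 - delta) * (#|T|%:R - 1) * energy T x <=
  (#|T|%:R - r%:R) * diagonal T x + (r%:R - 1) * '[lincomb T x, lincomb T x].
Proof.
move=> r1; have r1R : 0 < r%:R - 1 :> R by rewrite subr_gt0 ltr1n.
have [k] := ubnP #|T|; elim: k T => // k IH T Tk rT.
have [rE|rT'] := eqVneq r #|T|.
  rewrite -rE subrr mul0r add0r mulrAC mulrC ler_pM2l//.
  by have /andP[] := rip x (eq_leq (esym rE)).
have {rT'}rT : (r < #|T|)%N by rewrite ltn_neqAle rT'.
have [p pE] : exists p, #|T| = p.+1 by case: #|T| rT => // p _; exists p.
have p1 : (1 < p)%N by rewrite -ltnS -pE (leq_ltn_trans r1).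
have p1R : 0 < p%:R - 1 :> R by rewrite subr_gt0 ltr1n.
have h i : i \in T ->
    (1 - delta) * (p%:R - 1) * (energy T x - x i ^+ 2) <=
    (p%:R - r%:R) * (diagonal T x - x i ^+ 2 * '[z i, z i]) +
    (r%:R - 1) * ('[lincomb T x, lincomb T x] - 2 * (x i * '[z i, lincomb T x])
                  + x i ^+ 2 * '[z i, z i]).
  move=> iT; have cD : #|T :\ i| = p by move: pE; rewrite (cardsD1 i T) iT => -[].
  have := IH (T :\ i); rewrite cD; move/(_ _ _); rewrite lincomb_D1//.
  rewrite mxdotDl !mxdotDr !mxdotNl !mxdotNr !mxdotZl !mxdotZr (mxdotC _ (z i)).
  rewrite /energy /diagonal [in X in _ -> X](big_setD1 i iT)/=.
  rewrite [X in _ -> _ <= _ * (X - _) + _](big_setD1 i iT)/=.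
  rewrite ![x i ^+ 2 + _]addrC ![x i ^+ 2 * _ + _]addrC !addrK => /(_ _ _)/le_trans; apply.
  - by rewrite -ltnS -pE.
  - by rewrite -ltnS -pE.
  - by rewrite le_eqVlt; apply/orP; left; apply/eqP; ring.
have const (u : R) : \sum_(i in T) u = (p%:R + 1) * u.
  by rewrite sumr_const pE -[LHS]mulr_natl -[p.+1]addn1 natrD.
have sE : \sum_(i in T) (energy T x - x i ^+ 2) = p%:R * energy T x.
  by rewrite sumrB const -/(energy T x); ring.
have sD : \sum_(i in T) (diagonal T x - x i ^+ 2 * '[z i, z i]) = p%:R * diagonal T x.
  by rewrite sumrB const -/(diagonal T x); ring.
have sQ : \sum_(i in T) ('[lincomb T x, lincomb T x] -
      2 * (x i * '[z i, lincomb T x]) + x i ^+ 2 * '[z i, z i]) =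
    (p%:R - 1) * '[lincomb T x, lincomb T x] + diagonal T x.
  rewrite big_split/= sumrB const -mulr_sumr -lincomb_dot -/(diagonal T x).
  by ring.
have := ler_sum (index_enum _) h; rewrite /= big_split/= -!mulr_sumr sE sD sQ.
rewrite pE -[p.+1]addn1 natrD; move: (energy T x) (diagonal T x) '[_, _] => E D Q hs.
rewrite -(ler_pM2l p1R); apply: le_trans (le_trans _ hs) _.
  by rewrite le_eqVlt; apply/orP; left; apply/eqP; ring.
by rewrite le_eqVlt; apply/orP; left; apply/eqP; ring.
Qed.

(** The sum of the upper isometry bounds on the differences x_i z_i - x_j z_j over all
    pairs. *)
Lemma gram_pairs T x : (1 < r)%N ->
  #|T|%:R * diagonal T x - '[lincomb T x, lincomb T x] <=
  (1 + delta) * (#|T|%:R - 1) * energy T x.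
Proof.
move=> r1.
have const (u : R) : \sum_(i in T) u = #|T|%:R * u by rewrite sumr_const mulr_natl.
have h i j : i \in T -> j \in T ->
    x i ^+ 2 * '[z i, z i] + x j ^+ 2 * '[z j, z j] - 2 * (x i * (x j * '[z i, z j])) <=
    (1 + delta) * (x i ^+ 2 + x j ^+ 2 - (if i == j then 2 * x i ^+ 2 else 0)).
  move=> iT jT; have [->|ij] := eqVneq i j.
    by rewrite le_eqVlt; apply/orP; left; apply/eqP; ring.
  pose w k := if k == i then x i else - x j.
  have ijr : (#|[set i; j]| <= r)%N by rewrite cards2 ij.
  have /andP[_] := rip w ijr.
  rewrite /lincomb /energy !big_setU1 ?inE// !big_set1 /w eqxx eq_sym (negPf ij).
  rewrite mxdotDl !mxdotDr !mxdotZl !mxdotZr (mxdotC (z j)) subr0 sqrrN => /(le_trans _); apply.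
  by rewrite le_eqVlt; apply/orP; left; apply/eqP; ring.
have : \sum_(i in T) \sum_(j in T) (x i ^+ 2 * '[z i, z i] + x j ^+ 2 * '[z j, z j]
         - 2 * (x i * (x j * '[z i, z j]))) <=
       \sum_(i in T) \sum_(j in T) (1 + delta) *
         (x i ^+ 2 + x j ^+ 2 - (if i == j then 2 * x i ^+ 2 else 0)).
  by apply: ler_sum => i iT; apply: ler_sum => j jT; exact: h.
have -> : \sum_(i in T) \sum_(j in T) (x i ^+ 2 * '[z i, z i] + x j ^+ 2 * '[z j, z j]
         - 2 * (x i * (x j * '[z i, z j]))) =
    2 * (#|T|%:R * diagonal T x - '[lincomb T x, lincomb T x]).
  have inner i : \sum_(j in T) (x i ^+ 2 * '[z i, z i] + x j ^+ 2 * '[z j, z j]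
         - 2 * (x i * (x j * '[z i, z j]))) =
      #|T|%:R * (x i ^+ 2 * '[z i, z i]) + diagonal T x
         - 2 * (x i * '[z i, lincomb T x]).
    rewrite sumrB big_split/= const -!mulr_sumr; congr (_ - 2 * (_ * _)).
    by rewrite [RHS]mxdotC lincomb_dot; apply: eq_bigr => j _; rewrite mxdotC.
  under eq_bigr do rewrite inner.
  rewrite sumrB big_split/= const -!mulr_sumr -lincomb_dot -/(diagonal T x).
  by ring.
have -> : \sum_(i in T) \sum_(j in T) (1 + delta) *
         (x i ^+ 2 + x j ^+ 2 - (if i == j then 2 * x i ^+ 2 else 0)) =
    2 * ((1 + delta) * (#|T|%:R - 1) * energy T x).
  have inner i : i \in T -> \sum_(j in T) (1 + delta) *
         (x i ^+ 2 + x j ^+ 2 - (if i == j then 2 * x i ^+ 2 else 0)) =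
      (1 + delta) * (#|T|%:R * x i ^+ 2 + energy T x - 2 * x i ^+ 2).
    move=> iT; rewrite -mulr_sumr sumrB big_split/= const; congr (_ * (_ - _)).
    rewrite -big_mkcondr/= (big_pred1 i)// => j.
    by rewrite /= eq_sym andbC; case: eqP => // ->; rewrite iT.
  rewrite (eq_bigr _ inner) -mulr_sumr sumrB big_split/= const -!mulr_sumr.
  by rewrite -/(energy T x); ring.
by rewrite ler_pM2l ?ltr0n.
Qed.

(** Neither family of bounds alone gives this constant: the averages over
    subsets and over pairs have to be combined, with weights #|T| and #|T| - r, so
    that the diagonal of the Gram matrix cancels. *)
Lemma gram_lower T x : (1 < r)%N -> (r <= #|T|)%N ->
  (r%:R - delta * (2 * #|T|%:R - r%:R)) * energy T x <=
  r%:R * '[lincomb T x, lincomb T x].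
Proof.
move=> r1 rT; have := gram_average x r1 rT; have := gram_pairs T x r1.
have k1 : 0 < #|T|%:R - 1 :> R by rewrite subr_gt0 ltr1n (leq_trans r1).
have kr : 0 <= #|T|%:R - r%:R :> R by rewrite subr_ge0 ler_nat.
have k0 : 0 <= #|T|%:R :> R by [].
move: (energy T x) (diagonal T x) '[_, _] => E D Q h1 h2.
rewrite -(ler_pM2l k1).
have := ler_wpM2l kr h1; have := ler_wpM2l k0 h2.
move: #|T|%:R r%:R {h1 h2 k1 kr k0} => k s h1 h2.
by lra.
Qed.

End GramRIP.

(** * The constants of the null space property *)

Section NullSpaceProperty.
Variable R : realType.

(** The product t theta for the theta used in each of the two ranges of t. *)
Definition split_weight (t : R) : R :=
  if t <= 2 / 3 then Num.sqrt ((2 - t) / (1 - t)) else 2.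

(** Common value of psi / ((2 - t) t theta) and of phi / (t theta), each in its range
    of t. In these terms both ranges have the same formulas for the two constants. *)
Definition contraction (t delta : R) : R :=
  1 - delta * (2 / t - 1 + 2 / split_weight t).

Lemma split_weight_bounds t : 0 < t -> 0 < split_weight t <= 2.
Proof.
move=> t0; rewrite /split_weight; case: (leP t (2 / 3)) => t23; last first.
  by rewrite ltr0n lexx.
have d0 : 0 < 1 - t by lra.
rewrite sqrtr_gt0 divr_gt0//=; last by lra.
rewrite -[2 in leRHS]ger0_norm// -sqrtr_sqr ler_sqrt ?sqr_ge0//.
by rewrite ler_pdivrMr//; lra.
Qed.

Section Constants.
Variables t delta : R.
Hypotheses (t0 : 0 < t) (d0 : 0 < delta) (hb : delta < ric_bound t).

Let w := split_weight t.
Let A := contraction t delta.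

Let tn : t != 0. Proof. by rewrite gt_eqF. Qed.
Let w0 : 0 < w. Proof. by case/andP: (split_weight_bounds t0). Qed.
Let wn : w != 0. Proof. by rewrite gt_eqF. Qed.

(** This is where the bound on delta comes from: it says that the null space
    constant beta2 is less than 1. *)
Lemma ric_bound_contraction : delta * (w / t ^+ 2) < A.
Proof.
rewrite /A /contraction -/w -subr_gt0.
suff : delta * (2 / t - 1 + 2 / w + w / t ^+ 2) < 1 by move=> h; lra.
move: hb; rewrite /ric_bound /theta1 /w /split_weight.
case: (leP t (2 / 3)) => t23; last first.
  have p : 0 < 2 * (t + 1) by lra.
  rewrite ltr_pdivlMr// => h.
  rewrite (_ : _ + _ = 2 * (t + 1) / t ^+ 2); last by field.
  by rewrite mulrA ltr_pdivrMr ?exprn_gt0// mul1r.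
have u0 : 0 < 1 - t by lra.
have v0 : 0 < 2 - t by lra.
set s := Num.sqrt ((2 - t) / (1 - t)).
have s0 : 0 < s by rewrite sqrtr_gt0 divr_gt0.
have s2 : s ^+ 2 = (2 - t) / (1 - t) by rewrite sqr_sqrtr// divr_ge0// ltW.
have -> : Num.sqrt ((2 - t) * (1 - t)) = (2 - t) / s.
  rewrite (_ : (2 - t) * (1 - t) = ((2 - t) / s) ^+ 2); last first.
    by rewrite expr_div_n s2; field; rewrite !gt_eqF.
  by rewrite sqrtr_sqr ger0_norm// divr_ge0 ?ltW.
rewrite ltr_pdivlMr => [h|]; last first.
  rewrite !addr_gt0// ?exprn_gt0// ?mulr_gt0 ?divr_gt0 ?invr_gt0//.
rewrite -(@ltr_pM2r _ ((2 - t) * t)) ?mulr_gt0// mul1r.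
apply: le_lt_trans h; rewrite le_eqVlt; apply/orP; left; apply/eqP.
by field; rewrite ?gt_eqF.
Qed.

Lemma contraction_gt0 : 0 < A.
Proof.
apply: le_lt_trans ric_bound_contraction.
by rewrite mulr_ge0 ?divr_ge0 ?exprn_ge0 ?ltW.
Qed.

Let An : A != 0. Proof. by rewrite gt_eqF// contraction_gt0. Qed.

Let sqrt_t : Num.sqrt (t * (1 + delta)) = t * Num.sqrt ((1 + delta) / t).
Proof.
rewrite -{2}(ger0_norm (ltW t0)) -sqrtr_sqr -sqrtrM ?sqr_ge0//.
by congr Num.sqrt; field.
Qed.

Lemma psi_contraction : t <= 2 / 3 ->
  theta1 t = w / t /\ psi t delta (theta1 t) = (2 - t) * w * A.
Proof.
move=> t23; have u0 : 0 < 1 - t by lra.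
have th : theta1 t = w / t.
  by rewrite /theta1 /w /split_weight t23 mulrC.
have w2 : (1 - t) * w ^+ 2 = 2 - t.
  rewrite /w /split_weight t23 sqr_sqrtr ?divr_ge0 ?ltW//; last by lra.
  by field; rewrite gt_eqF.
split=> //; rewrite th.
rewrite (_ : psi _ _ _ = (2 - t) * w -
    ((2 - t) * (1 + (2 - t) * w / t) + (1 - t) * w ^+ 2) * delta); last first.
  by rewrite /psi; field.
by rewrite w2 /A /contraction -/w; field; rewrite wn.
Qed.

Lemma phi_contraction : 2 / 3 < t -> w = 2 /\ phi t delta (theta2 t) = 2 * A.
Proof.
move=> t23; have w2 : w = 2 by rewrite /w /split_weight leNgt t23.
by split=> //; rewrite /phi /A /contraction -/w w2 /theta2; field.
Qed.

Lemma beta1E : beta1 t delta = Num.sqrt ((1 + delta) / t) / A.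
Proof.
rewrite /beta1 sqrt_t; move: (Num.sqrt ((1 + delta) / t)) => q.
case: (leP t (2 / 3)) => t23.
  have [-> ->] := psi_contraction t23; have v0 : 0 < 2 - t by lra.
  by field; rewrite An wn tn gt_eqF.
by have [_ ->] := phi_contraction t23; rewrite /theta2; field; rewrite An tn.
Qed.

Lemma beta2E : beta2 t delta = Num.sqrt (delta * (w / t ^+ 2) / A).
Proof.
have pull x y : 0 <= x -> x * Num.sqrt y = Num.sqrt (x ^+ 2 * y) :> R.
  by move=> x0; rewrite sqrtrM ?sqr_ge0// sqrtr_sqr ger0_norm.
rewrite /beta2; case: (leP t (2 / 3)) => t23.
  have [-> ->] := psi_contraction t23; have v0 : 0 < 2 - t by lra.
  rewrite pull ?divr_ge0 ?ltW//; congr Num.sqrt.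
  by field; rewrite An wn tn gt_eqF.
have [-> ->] := phi_contraction t23.
rewrite /theta2 pull ?divr_ge0 ?ltW//; congr Num.sqrt.
by field; rewrite An tn.
Qed.

Lemma beta1_gt0 : 0 < beta1 t delta.
Proof.
by rewrite beta1E divr_gt0 ?contraction_gt0// sqrtr_gt0 divr_gt0// addr_gt0.
Qed.

Lemma beta2_ge0 : 0 <= beta2 t delta.
Proof. by rewrite beta2E sqrtr_ge0. Qed.

Lemma beta2_lt1 : beta2 t delta < 1.
Proof.
rewrite beta2E -sqrtr1 ltr_sqrt// ltr_pdivrMr ?contraction_gt0// mul1r.
exact: ric_bound_contraction.
Qed.

End Constants.

End NullSpaceProperty.

(** * The null space property *)

Section HeadTail.
Variables (R : realType) (n k : nat).
Hypotheses (k0 : (0 < k)%N) (kn : (k <= n)%N).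

Definition head := [set i : 'I_n | (i < k)%N].

Lemma card_head : #|head| = k.
Proof.
rewrite cardsE -sum1_card (eq_bigl (fun i : 'I_n => (i < k)%N)) => [|i]; last by [].
by rewrite -(big_ord_widen n (fun=> 1%N) kn) sum1_card card_ord.
Qed.

Lemma big_head (F : 'I_n -> R) :
  \sum_(i in head) F i = \sum_(i < n | (i < k)%N) F i.
Proof. by apply: eq_bigl => i; rewrite inE. Qed.

Lemma big_tail (F : 'I_n -> R) :
  \sum_(i in ~: head) F i = \sum_(i < n | (k <= i)%N) F i.
Proof. by apply: eq_bigl => i; rewrite !inE -leqNgt. Qed.

Variable x : 'I_n -> R.
Hypothesis x0 : forall i, 0 <= x i.
Hypothesis x_sorted : forall i j : 'I_n, (i <= j)%N -> x j <= x i.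

Let k0R : 0 < k%:R :> R. Proof. by rewrite ltr0n. Qed.

(** Every tail entry is at most the smallest head entry, hence at most the
    quadratic mean of the head. *)
Lemma tail_le (i : 'I_n) : (k <= i)%N ->
  x i <= Num.sqrt (energy head x) / Num.sqrt k%:R.
Proof.
move=> ki; rewrite -(@ler_sqr R) ?nnegrE ?divr_ge0 ?sqrtr_ge0//.
rewrite expr_div_n !sqr_sqrtr ?energy_ge0 ?(ltW k0R)// ler_pdivlMr//.
rewrite mulr_natr -card_head -sumr_const.
apply: ler_sum => j; rewrite inE => jk; rewrite lerXn2r ?nnegrE//.
by apply: x_sorted; apply: leq_trans ki; exact: ltnW.
Qed.

(** The energy of the tail is at most its largest entry times its sum; complete the
    square. *)
Lemma norm_le_head_tail : Num.sqrt (\sum_i x i ^+ 2) <=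
  Num.sqrt (\sum_(i < n | (i < k)%N) x i ^+ 2) +
  (\sum_(i < n | (k <= i)%N) x i) / (2 * Num.sqrt k%:R).
Proof.
have s0 : 0 < Num.sqrt k%:R :> R by rewrite sqrtr_gt0.
set D := \sum_(i < n | (k <= i)%N) x i; have D0 : 0 <= D by apply: sumr_ge0.
have tl : \sum_(i < n | (k <= i)%N) x i ^+ 2 <=
    Num.sqrt (energy head x) / Num.sqrt k%:R * D.
  rewrite mulr_sumr; apply: ler_sum => i ki; rewrite expr2 ler_wpM2r//.
  exact: tail_le.
rewrite (bigID (fun i : 'I_n => (i < k)%N))/= -big_head -/(energy head x).
under [X in _ + X]eq_bigl do rewrite -leqNgt.
have qE : Num.sqrt (energy head x) ^+ 2 = energy head x by rewrite sqr_sqrtr ?energy_ge0.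
have y0 : 0 <= Num.sqrt (energy head x) + D / (2 * Num.sqrt k%:R).
  by rewrite addr_ge0 ?sqrtr_ge0 ?divr_ge0 ?mulr_ge0 ?(ltW s0).
rewrite -[leRHS]ger0_norm// -sqrtr_sqr ler_wsqrtr// -[X in X + _]qE.
rewrite [leRHS](_ : _ =
  Num.sqrt (energy head x) ^+ 2 + Num.sqrt (energy head x) / Num.sqrt k%:R * D +
  (D / (2 * Num.sqrt k%:R)) ^+ 2).
  by rewrite -addrA lerD2l (le_trans tl)// lerDl sqr_ge0.
by field; rewrite gt_eqF.
Qed.

Lemma head_sum_le : \sum_(i < n | (i < k)%N) x i <=
  Num.sqrt k%:R * Num.sqrt (\sum_(i < n | (i < k)%N) x i ^+ 2).
Proof.
have kh : (0 < 1 <= #|head|)%N by rewrite card_head.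
have := @sum_le_of_subsets R _ 1 x x 1 head kh ler01.
rewrite mul1r divr1 card_head -!big_head; apply => S _ /eqP/cards1P[i ->].
by rewrite !big_set1 mul1r sqrtr_sqr ler_norm.
Qed.

End HeadTail.

Section HeadBound.
Variables (R : realType) (m n : nat) (z : 'I_n -> 'cV[R]_m).
Variables (r k : nat) (t delta : R) (x : 'I_n -> R).
Hypotheses (r1 : (1 < r)%N) (rk : (r <= k)%N) (kn : (k <= n)%N).
Hypotheses (t0 : 0 < t) (tkr : t * k%:R <= r%:R).
Hypotheses (rip : sparse_RIP z r delta) (d0 : 0 < delta).
Hypothesis x0 : forall i, 0 <= x i.
Hypothesis x_sorted : forall i j : 'I_n, (i <= j)%N -> x j <= x i.

Let T := head n k.
Let P := ~: T.
Let X := Num.sqrt (energy T x).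
Let S1 := \sum_(i in P) x i.
Let tau := S1 / Num.sqrt k%:R.
Let w := split_weight t.

Let k0 : (0 < k)%N. Proof. exact: leq_trans (ltnW r1) rk. Qed.
Let k0R : 0 < k%:R :> R. Proof. by rewrite ltr0n. Qed.
Let r0R : 0 < r%:R :> R. Proof. by rewrite ltr0n ltnW. Qed.
Let X0 : 0 <= X. Proof. exact: sqrtr_ge0. Qed.
Let X2 : X ^+ 2 = energy T x. Proof. by rewrite sqr_sqrtr ?energy_ge0. Qed.
Let S10 : 0 <= S1. Proof. by apply: sumr_ge0. Qed.
Let tau2 : tau ^+ 2 = S1 ^+ 2 / k%:R.
Proof. by rewrite expr_div_n sqr_sqrtr// ltW. Qed.

(** The loss in the head-tail interaction for the split r = a + b in (almost) equal
    parts. The scale alpha of the tail is its height or its mean over b entries;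
    in the second case 8 a b >= r^2 leaves room for the arithmetic-geometric mean
    inequality. *)
Lemma cross_term :
  - '[lincomb z T x, lincomb z P x] <=
  delta * (2 / w * X ^+ 2 + w / t ^+ 2 * tau ^+ 2).
Proof.
have /andP[w0 w2] := split_weight_bounds t0; rewrite -/w in w0 w2.
pose b := r./2; pose a := (r - b)%N.
have b0 : (0 < b)%N by rewrite /b; lia.
have ba : (b <= a)%N by rewrite /a /b; lia.
have abr : (a + b)%N = r by rewrite /a /b; lia.
have ab8 : (r ^ 2 <= 8 * (a * b))%N.
  have : (a <= b.+1)%N by rewrite /a /b; lia.
  by move=> ab1; rewrite -abr; nia.
have a0 : (0 < a)%N by exact: leq_trans ba.
have a0R : 0 < a%:R :> R by rewrite ltr0n.
have b0R : 0 < b%:R :> R by rewrite ltr0n.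
pose alpha := Num.max (X / Num.sqrt k%:R) (S1 / b%:R).
have al0 : 0 <= alpha by rewrite le_max divr_ge0 ?sqrtr_ge0.
have aT : (0 < a <= #|T|)%N by rewrite a0 (card_head kn) (leq_trans _ rk)// -abr leq_addr.
have TP : [disjoint T & P] by rewrite -setI_eq0 setICr.
have va i : i \in P -> 0 <= x i <= alpha.
  by move=> iP; rewrite x0 le_max tail_le//; move: iP; rewrite !inE -leqNgt.
have sv : \sum_(i in P) x i <= b%:R * alpha.
  by rewrite -ler_pdivrMl// le_max mulrC lexx orbT.
have [L LE] : exists L, L = 2 / w * X ^+ 2 by eexists.
have [M ME] : exists M, M = w / t ^+ 2 * tau ^+ 2 by eexists.
rewrite -LE -ME.
have := head_tail_ge rip d0 x TP aT (eq_leq abr) al0 va sv.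
move=> /le_trans; apply; rewrite -!mulrA ler_wpM2l ?(ltW d0)// (card_head kn) -/X.
have L0 : 0 <= L by rewrite LE mulr_ge0 ?sqr_ge0// divr_ge0// ltW.
have M0 : 0 <= M by rewrite ME mulr_ge0 ?sqr_ge0// divr_ge0 ?sqr_ge0// ltW.
rewrite -(@ler_sqr R) ?nnegrE ?addr_ge0 ?mulr_ge0 ?sqrtr_ge0//.
have sq (Y : R) : (alpha * (Num.sqrt b%:R * (Num.sqrt (k%:R / a%:R) * Y))) ^+ 2 =
    alpha ^+ 2 * (b%:R * (k%:R / a%:R * Y ^+ 2)).
  by rewrite !exprMn !sqr_sqrtr ?divr_ge0 ?(ltW k0R) ?(ltW b0R) ?(ltW a0R).
rewrite sq /alpha; case: (leP (X / Num.sqrt k%:R)) => _.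
  have -> : (S1 / b%:R) ^+ 2 * (b%:R * (k%:R / a%:R * X ^+ 2)) =
      (k%:R ^+ 2 / (a%:R * b%:R)) * (X ^+ 2 * tau ^+ 2).
    by rewrite tau2; field; rewrite !gt_eqF.
  apply: (@le_trans _ _ (4 * (L * M))); last first.
    by have := sqr_ge0 (L - M); lra.
  have -> : 4 * (L * M) = 8 / t ^+ 2 * (X ^+ 2 * tau ^+ 2).
    by rewrite LE ME; field; rewrite !gt_eqF.
  apply: ler_wpM2r; first exact: mulr_ge0 (sqr_ge0 _) (sqr_ge0 _).
  rewrite ler_pdivlMr ?exprn_gt0// mulrAC ler_pdivrMr ?mulr_gt0//.
  apply: (@le_trans _ _ (r%:R ^+ 2)).
    rewrite mulrC -exprMn lerXn2r ?nnegrE ?mulr_ge0 ?(ltW t0)//.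
  by rewrite -!natrM -natrX ler_nat.
rewrite expr_div_n (sqr_sqrtr (ltW k0R)).
have -> : X ^+ 2 / k%:R * (b%:R * (k%:R / a%:R * X ^+ 2)) =
    b%:R / a%:R * (X ^+ 2) ^+ 2 by field; rewrite !gt_eqF.
apply: (@le_trans _ _ ((X ^+ 2) ^+ 2)).
  by rewrite ler_piMl ?sqr_ge0// ler_pdivrMr// mul1r ler_nat.
rewrite lerXn2r ?nnegrE ?sqr_ge0 ?addr_ge0//.
apply: (@le_trans _ _ L); last by rewrite lerDl.
by rewrite LE ler_peMl ?sqr_ge0// ler_pdivlMr// mul1r.
Qed.

Let Bx := lincomb z setT x.

(** The head interacts with the whole vector at most through the measurement, and at
    least through its own isometry bound minus the interaction with the tail. *)
Lemma head_quadratic : X ^+ 2 * contraction t delta <=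
  Num.sqrt ((1 + delta) / t) * Num.sqrt '[Bx, Bx] * X + delta * (w / t ^+ 2) * tau ^+ 2.
Proof.
have tk : k%:R / r%:R <= t^-1.
  by rewrite ler_pdivrMr// ler_pdivlMl.
have BxE : Bx = lincomb z T x + lincomb z P x.
  rewrite /Bx /lincomb (big_setID T)/= setTI; congr (_ + _).
  by apply: eq_bigl => i; rewrite !inE andbT.
have lower := gram_lower rip (T := T) x r1; rewrite (card_head kn) in lower.
have {}lower := lower rk; rewrite -X2 in lower.
have low : (1 - delta * (2 / t - 1)) * X ^+ 2 <= '[lincomb z T x, lincomb z T x].
  rewrite -(ler_pM2l r0R); apply: le_trans lower.
  rewrite mulrA ler_wpM2r ?sqr_ge0// mulrBr mulr1 lerD2l lerN2.
  rewrite mulrCA ler_wpM2l ?(ltW d0)// mulrBr mulr1 lerD2r.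
  by rewrite mulrCA ler_pM2l// ler_pdivlMr// mulrC.
have cross := cross_term.
have rT : (0 < r <= #|T|)%N by rewrite (card_head kn) rk ltnW.
have up := lincomb_dot_upper rip d0 x Bx rT; rewrite (card_head kn) -/X in up.
have d1 : 0 <= 1 + delta by rewrite addr_ge0// ltW.
have {}up : '[lincomb z T x, Bx] <=
    Num.sqrt ((1 + delta) / t) * Num.sqrt '[Bx, Bx] * X.
  apply: (le_trans up); rewrite ler_wpM2r// mulrAC ler_wpM2r ?sqrtr_ge0//.
  rewrite -sqrtrM// ler_wsqrtr// ler_wpM2l//.
have : '[lincomb z T x, Bx] =
    '[lincomb z T x, lincomb z T x] + '[lincomb z T x, lincomb z P x].
  by rewrite BxE mxdotDr.
move: up low cross; rewrite /contraction -/w.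
move: ('[_, Bx]) ('[lincomb z T x, _]) ('[_, _]) => p q s up low cross e.
by lra.
Qed.

End HeadBound.

Section QuadraticBound.
Variable R : realType.

Lemma quadratic_bound (X A p q : R) : 0 <= X -> 0 < A -> 0 <= p -> 0 <= q ->
  X ^+ 2 * A <= p * X + q ^+ 2 * A -> X <= p / A + q.
Proof.
move=> X0 A0 p0 q0 h; rewrite leNgt; apply/negP => XX.
have h1 : p + q * A < X * A.
  by move: XX; rewrite -(@ltr_pM2r _ A)// mulrDl divfK ?gt_eqF.
have qX : q < X.
  by apply: le_lt_trans XX; rewrite lerDr divr_ge0// ltW.
have h2 : 0 < X by exact: le_lt_trans qX.
have : (p + q * A) * X < X * A * X by rewrite ltr_pM2r.
have : q * A * q <= q * A * X by rewrite ler_wpM2l ?(ltW qX)// mulr_ge0// ltW.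
by lra.
Qed.

(** Solving the quadratic inequality for the norm of the head gives the robust null
    space property, with the two constants of the theorem. *)
Lemma sparse_null_space_property m n (z : 'I_n -> 'cV[R]_m) r k t delta
    (x : 'I_n -> R) :
  (1 < r)%N -> (r <= k)%N -> (k <= n)%N -> 0 < t -> t * k%:R <= r%:R ->
  sparse_RIP z r delta -> 0 < delta -> delta < ric_bound t ->
  (forall i, 0 <= x i) -> (forall i j : 'I_n, (i <= j)%N -> x j <= x i) ->
  Num.sqrt (\sum_(i < n | (i < k)%N) x i ^+ 2) <=
    beta1 t delta * Num.sqrt '[\sum_i x i *: z i, \sum_i x i *: z i] +
    beta2 t delta * ((\sum_(i < n | (k <= i)%N) x i) / Num.sqrt k%:R).
Proof.
move=> r1 rk kn t0 tkr rip d0 hb x0 srt.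
have h := head_quadratic r1 rk kn t0 tkr rip d0 x0 srt.
have A0 := contraction_gt0 t0 d0 hb.
have /andP[w0 _] := split_weight_bounds t0.
pose S1 := \sum_(i < n | (k <= i)%N) x i.
have S10 : 0 <= S1 by apply: sumr_ge0.
have eB : lincomb z [set: 'I_n]%SET x = \sum_i x i *: z i.
  by apply: eq_bigl => i; rewrite inE.
rewrite /energy big_head big_tail eB in h.
rewrite beta1E// beta2E// -/S1 mulrAC.
apply: (quadratic_bound _ A0); rewrite ?sqrtr_ge0//.
- by rewrite mulr_ge0 ?sqrtr_ge0.
- by rewrite mulr_ge0 ?divr_ge0 ?sqrtr_ge0.
apply: le_trans h _; rewrite lerD2l; move: (S1 / _) => tau; rewrite exprMn sqr_sqrtr.
  by rewrite [leRHS]mulrAC divfK ?gt_eqF.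
apply: divr_ge0; last exact: ltW.
by apply: mulr_ge0 (ltW d0) _; apply: divr_ge0; [exact: ltW|exact: sqr_ge0].
Qed.

End QuadraticBound.

(** * Nuclear norm, optimality and the final estimate *)

Section Assembly.
Variable R : realType.

Lemma frobenius_norm_sqr n1 n2 (X : 'M[R]_(n1, n2)) : frobenius_norm X ^+ 2 = '[X, X].
Proof.
rewrite sqr_sqrtr ?mxdotE; last first.
  by apply: sumr_ge0 => i _; apply: sumr_ge0 => j _; exact: sqr_ge0.
by apply: eq_bigr => i _; apply: eq_bigr => j _.
Qed.

Lemma l2normE m (v : 'cV[R]_m) : l2norm v = Num.sqrt '[v, v].
Proof. by rewrite mxdot_cV. Qed.

Lemma l2norm_sqr m (v : 'cV[R]_m) : l2norm v ^+ 2 = '[v, v].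
Proof. by rewrite l2normE sqr_sqrtr ?mxdot_ge0. Qed.

Section Measure.
Variables (n1 n2 m : nat) (A : 'I_m -> 'M[R]_(n1, n2)).

Lemma measure_mapE X i : measure_map A X i 0 = '[A i, X].
Proof. by rewrite mxE /mxdot mxtrace_mulC. Qed.

Lemma measure_map_sum (I : finType) (x : I -> R) (M : I -> 'M[R]_(n1, n2)) :
  measure_map A (\sum_i x i *: M i) = \sum_i x i *: measure_map A (M i).
Proof.
apply/colP => l; rewrite measure_mapE mxdot_sumr summxE; apply: eq_bigr => i _.
by rewrite mxdotZr mxE measure_mapE.
Qed.

Lemma measure_mapB X Y : measure_map A (X - Y) = measure_map A X - measure_map A Y.
Proof.
apply/colP => l; have subE (u v : 'cV[R]_m) : (u - v) l 0 = u l 0 - v l 0.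
  by rewrite !mxE.
by rewrite subE !measure_mapE mxdotDr mxdotNr.
Qed.

Variables (U : 'M[R]_n1) (V : 'M[R]_(n2, n1)).
Hypotheses (UU : U^T *m U = 1%:M) (VV : V^T *m V = 1%:M).

Definition singular_measurement (i : 'I_n1) : 'cV[R]_m :=
  measure_map A (col i U *m (col i V)^T).

Lemma measure_map_svd (x : 'rV_n1) : measure_map A (U *m diag_mx x *m V^T) =
  \sum_i x 0 i *: singular_measurement i.
Proof. by rewrite mulmx_diag_sum measure_map_sum. Qed.

Lemma mxdot_svd (x : 'rV[R]_n1) :
  '[U *m diag_mx x *m V^T, U *m diag_mx x *m V^T] = \sum_i x 0 i ^+ 2.
Proof.
rewrite mxdot_isometry// -mxdot_tr !trmx_mul mxdot_isometry// tr_diag_mx mxdotE.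
apply: eq_bigr => i _; rewrite (bigD1 i)//= big1 => [|j ji].
  by rewrite !mxE eqxx addr0.
by rewrite !mxE eq_sym (negPf ji) mul0r.
Qed.

Lemma rank_svd_support (x : 'rV[R]_n1) (S : {set 'I_n1}) :
  (forall i, i \notin S -> x 0 i = 0) -> (\rank (U *m diag_mx x *m V^T) <= #|S|)%N.
Proof.
move=> xS; rewrite mulmx_diag_sum (bigID (mem S))/= [X in _ + X]big1 ?addr0; last first.
  by move=> i /xS->; rewrite scale0r.
rewrite -sum1_card; elim/big_rec2: _ => [|i y1 y2 _ IH]; first by rewrite mxrank0.
apply: leq_trans (mxrank_add _ _) _; apply: leq_add => //.
rewrite scalemxAl; apply: leq_trans (mxrankM_maxl _ _) _; exact: rank_leq_col.
Qed.

(** On matrices with fixed singular vectors, the rank is the sparsity of the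
    vector of singular values. *)
Lemma RIP_sparse r delta : RIP A r delta -> sparse_RIP singular_measurement r delta.
Proof.
move=> rip S x Sr; pose y : 'rV[R]_n1 := \row_i (if i \in S then x i else 0).
have ry : (\rank (U *m diag_mx y *m V^T) <= r)%N.
  apply: leq_trans Sr; apply: rank_svd_support => i iS.
  by rewrite mxE (negPf iS).
have [lo hi] := rip _ ry; move: lo hi.
rewrite frobenius_norm_sqr l2norm_sqr mxdot_svd measure_map_svd.
have -> : \sum_i y 0 i ^+ 2 = energy S x.
  rewrite /energy [RHS]big_mkcond; apply: eq_bigr => i _; rewrite mxE.
  by case: ifP => // _; rewrite expr0n.
have -> : \sum_i y 0 i *: singular_measurement i = lincomb singular_measurement S x.
  rewrite /lincomb [RHS]big_mkcond; apply: eq_bigr => i _; rewrite mxE.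
  by case: ifP => // _; rewrite scale0r.
by move=> -> ->.
Qed.

End Measure.

Lemma nuclear_norm_tail n1 n2 k (X : 'M[R]_(n1, n2)) U s V : is_svd X U s V ->
  nuclear_norm (X - svd_partial_sum k U s V) = \sum_(i < n1 | (k <= i)%N) s 0 i.
Proof.
move=> /is_svdP[[UU VV s0 XE] _].
pose s' : 'rV[R]_n1 := \row_i (if (k <= i)%N then s 0 i else 0).
have h : unsorted_svd (X - svd_partial_sum k U s V) U s' V.
  split=> //; first by move=> i; rewrite mxE; case: ifP.
  rewrite XE svd_partial_sumE -mulmxBl -mulmxBr; congr (_ *m _ *m _).
  apply/matrixP => i j; rewrite !mxE ltnNge; case: (k <= i)%N; case: (_ == _) => /=;
    by rewrite ?mulr1n ?mulr0n ?subr0 ?subrr.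
rewrite (nuclear_normE h) [RHS]big_mkcond; apply: eq_bigr => i _.
by rewrite mxE.
Qed.

(** Mirsky's inequality for X and - H, where the sign with which an absolute value is
    opened depends on the position of the index relative to k. *)
Lemma nuclear_norm_cone n1 n2 k (X H : 'M[R]_(n1, n2)) U s V U' h V' :
  (n1 <= n2)%N -> is_svd X U s V -> is_svd H U' h V' ->
  nuclear_norm X - nuclear_norm (X + H) <=
    2 * (\sum_(i < n1 | (k <= i)%N) s 0 i) +
    \sum_(i < n1 | (i < k)%N) h 0 i - \sum_(i < n1 | (k <= i)%N) h 0 i.
Proof.
move=> n12 svdX /is_svdP[[UU VV h0 HE] hs].
have svdN : is_svd (- H) (- U') h V'.
  apply/is_svdP; split=> //; split=> //.
    have -> : (- U')^T = - U'^T by apply/matrixP => i j; rewrite !mxE.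
    by rewrite mulNmx mulmxN opprK UU.
  by rewrite HE !mulNmx.
have := mirsky_nuclear n12 svdX svdN; rewrite opprK.
have [uX _] := (is_svdP _ _ _ _).1 svdX.
rewrite (nuclear_normE uX) (bigID (fun i : 'I_n1 => (k <= i)%N))/=.
rewrite [\sum_i s 0 i](bigID (fun i : 'I_n1 => (k <= i)%N))/=.
have e (F : 'I_n1 -> R) : \sum_(i < n1 | ~~ (k <= i)%N) F i = \sum_(i < n1 | (i < k)%N) F i.
  by apply: eq_bigl => i; rewrite ltnNge.
rewrite !e => mir.
have t1 : \sum_(i < n1 | (k <= i)%N) h 0 i - \sum_(i < n1 | (k <= i)%N) s 0 i <=
    \sum_(i < n1 | (k <= i)%N) `|s 0 i - h 0 i|.
  rewrite -sumrB; apply: ler_sum => i _.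
  by rewrite distrC ler_norm.
have t2 : \sum_(i < n1 | (i < k)%N) s 0 i - \sum_(i < n1 | (i < k)%N) h 0 i <=
    \sum_(i < n1 | (i < k)%N) `|s 0 i - h 0 i|.
  by rewrite -sumrB; apply: ler_sum => i _; exact: ler_norm.
by lra.
Qed.

(** The data-fidelity term turns optimality into a quadratic inequality in
    the measurement of the error. *)
Lemma optimality_inequality n1 n2 m (A : 'I_m -> 'M[R]_(n1, n2)) lambda eps X e b Xs :
  0 < lambda -> l2norm e <= eps -> b = measure_map A X + e ->
  optimal_solution A lambda b Xs ->
  l2norm (measure_map A (Xs - X)) ^+ 2 - 2 * eps * l2norm (measure_map A (Xs - X)) <=
  2 * lambda * (nuclear_norm X - nuclear_norm Xs).
Proof.
move=> l0 he hb opt; set y := l2norm (measure_map A (Xs - X)).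
have := opt X; rewrite /objective.
have -> : b - measure_map A X = e by rewrite hb addrC addKr.
have -> : b - measure_map A Xs = e - measure_map A (Xs - X).
  by rewrite measure_mapB hb opprB -addrA addrCA.
have cs : '[e, measure_map A (Xs - X)] <= eps * y.
  apply: (@le_trans _ _ (l2norm e * y)); last by rewrite ler_wpM2r// sqrtr_ge0.
  apply: le_trans (ler_norm _) _.
  rewrite -(@ler_sqr R) ?nnegrE ?mulr_ge0 ?sqrtr_ge0// real_normK ?num_real//.
  by rewrite exprMn !l2norm_sqr mxdot_CS.
rewrite (l2norm_sqr e) (l2norm_sqr (e - _)) mxdotDl !mxdotDr !mxdotNl !mxdotNr opprK.
rewrite (mxdotC _ e) -(l2norm_sqr (measure_map A (Xs - X))) -/y.
rewrite -(@ler_pM2l _ (2 * lambda)) ?mulr_gt0// !(mulrDr (2 * lambda) (nuclear_norm _)).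
rewrite !mulrA !mulfV ?mul1r ?mulf_neq0 ?gt_eqF//.
by move: ('[e, e]) ('[e, _]) cs => ee ey cs h; lra.
Qed.

(** With E = sqrt k b1 lambda + eps, eliminating x leaves
    y^2 - 2 E y <= 2 lambda (2 rho - (1 - b2) T). Dropping T bounds y by
    2 E + 2 lambda rho / E, and maximizing over y bounds T. *)
Lemma error_arithmetic (k : nat) b1 b2 lambda eps rho T x y N : (0 < k)%N ->
  0 < b1 -> 0 <= b2 -> b2 < 1 -> 0 < lambda -> 0 <= eps -> 0 <= rho -> 0 <= T ->
  let sk := Num.sqrt k%:R : R in
  x <= b1 * y + b2 * (T / sk) ->
  y ^+ 2 - 2 * eps * y <= 2 * lambda * (2 * rho + sk * x - T) ->
  N <= x + T / (2 * sk) ->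
  N <= C3 k b1 b2 lambda eps * rho + C4 k b1 b2 lambda eps.
Proof.
move=> k0 b10 b20 b21 l0 e0 r0 T0 sk hx hy hN.
have s0 : 0 < sk by rewrite sqrtr_gt0 ltr0n.
rewrite /C3 /C4 -/sk; move: sk s0 hx hy hN => sk s0 hx hy hN.
pose p := sk * b1; have p0 : 0 < p by rewrite mulr_gt0.
have [E EE] : exists E, E = p * lambda + eps by eexists.
have E0 : 0 < E by rewrite EE ltr_wpDr// mulr_gt0.
have skx : sk * x <= p * y + b2 * T.
  have := ler_wpM2l (ltW s0) hx; rewrite /p => /le_trans; apply.
  by rewrite le_eqVlt; apply/orP; left; apply/eqP; field; rewrite gt_eqF.
have quad : y ^+ 2 - 2 * E * y <= 2 * lambda * (2 * rho - (1 - b2) * T).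
  have : lambda * (sk * x) <= lambda * (p * y + b2 * T) by rewrite ler_wpM2l// ltW.
  by rewrite EE => h; lra.
have yb : y <= 2 * E + 2 * lambda * rho / E.
  have q0 : 0 <= 2 * lambda * rho / E by rewrite divr_ge0 ?mulr_ge0 ?(ltW E0) ?(ltW l0).
  rewrite -lerBlDl; apply: (@le_trans _ _ (`|y - E| - E)).
    by have := ler_norm (y - E); lra.
  rewrite lerBlDr -ler_sqr ?nnegrE ?addr_ge0 ?(ltW E0)// real_normK ?num_real//.
  rewrite [leRHS](_ : _ = (2 * lambda * rho / E) ^+ 2 + 4 * lambda * rho + E ^+ 2); last first.
    by field; rewrite gt_eqF.
  have : 0 <= lambda * ((1 - b2) * T) by rewrite !mulr_ge0 ?(ltW l0)// subr_ge0 ltW.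
  have := sqr_ge0 (2 * lambda * rho / E).
  by move=> h1 h2; lra.
have Tb : T <= (2 * rho + E ^+ 2 / (2 * lambda)) / (1 - b2).
  rewrite ler_pdivlMr ?subr_gt0//.
  rewrite -(@ler_pM2l _ (2 * lambda)) ?mulr_gt0//.
  rewrite [leRHS](_ : _ = 4 * lambda * rho + E ^+ 2); last by field; rewrite gt_eqF.
  by have := sqr_ge0 (y - E); lra.
apply: le_trans hN _; rewrite -(@ler_pM2l _ sk)//.
apply: (@le_trans _ _ (p * y + (b2 + 1 / 2) * T)).
  rewrite mulrDr [sk * (T / _)](_ : _ = T / 2); last by field; rewrite gt_eqF.
  by lra.
apply: (@le_trans _ _ (p * (2 * E + 2 * lambda * rho / E) +
    (b2 + 1 / 2) * ((2 * rho + E ^+ 2 / (2 * lambda)) / (1 - b2)))).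
  apply: lerD; first by rewrite ler_wpM2l// ltW.
  by rewrite ler_wpM2l//; lra.
rewrite -subr_ge0.
(* what is left of the coefficients of rho and of E in C3 and C4 *)
pose g1 := p * lambda * (3 + 6 * b2 + 2 * b2 ^+ 2) + eps * (1 + 6 * b2 + 4 * b2 ^+ 2).
pose g2 := p * lambda * (11 / 4 + 7 / 2 * b2) + eps * (3 / 4 + 7 / 2 * b2 + 2 * b2 ^+ 2).
rewrite (_ : _ - _ = rho * g1 / ((1 - b2) * E) + E * g2 / ((1 - b2) * lambda)).
  have b2s := sqr_ge0 b2; have pl : 0 <= p * lambda by rewrite mulr_ge0 ?ltW.
  have b1p : 0 < 1 - b2 by rewrite subr_gt0.
  have g10 : 0 <= g1 by rewrite /g1 addr_ge0 ?mulr_ge0//; lra.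
  have g20 : 0 <= g2 by rewrite /g2 addr_ge0 ?mulr_ge0//; lra.
  by rewrite addr_ge0 ?divr_ge0 ?mulr_ge0 ?(ltW E0) ?(ltW b1p) ?(ltW l0).
have En : sk * b1 * lambda + eps != 0 by rewrite -/p -EE gt_eqF.
rewrite EE /g1 /g2 /p; field.
by rewrite En !gt_eqF// subr_gt0.
Qed.

End Assembly.

Theorem theorem4p4 (R : realType) (n1 n2 m k : nat)
    (A : 'I_m -> 'M[R]_(n1, n2)) (t lambda eps delta : R)
    (hn : (n1 <= n2)%N)
    (ht : 0 < t <= 1)
    (hk0 : (0 < k)%N) (hkn : (k < n1)%N)
    (htkn : t * k%:R < n1%:R)
    (htk1 : 1 < t * k%:R)
    (hlambda : 0 < lambda) (heps : 0 <= eps)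
    (hdelta : is_RIC A (t * k%:R) delta)
    (hbound : delta < ric_bound t)
    (X : 'M[R]_(n1, n2)) (U : 'M[R]_n1) (s : 'rV[R]_n1) (V : 'M[R]_(n2, n1))
    (hsvd : is_svd X U s V)
    (e b : 'cV[R]_m)
    (he : l2norm e <= eps)
    (hb : b = measure_map A X + e)
    (Xs : 'M[R]_(n1, n2))
    (hXs : optimal_solution A lambda b Xs) :
  frobenius_norm (Xs - X) <=
    C3 k (beta1 t delta) (beta2 t delta) lambda eps *
      nuclear_norm (X - svd_partial_sum k U s V) +
    C4 k (beta1 t delta) (beta2 t delta) lambda eps.
Proof.
have /andP[t0 t1] := ht; have k0R : 0 < k%:R :> R by rewrite ltr0n.
pose c := Num.ceil (t * k%:R); pose r := `|c|%N.
have c0 : 0 <= c by rewrite ceil_ge0; lra.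
have rc : r%:Z = c by rewrite /r gez0_abs.
have r1 : (1 < r)%N by rewrite -ltz_nat rc ceil_gt_int.
have rk : (r <= k)%N.
  by rewrite -lez_nat rc ceil_le_int ler_piMl// ltW.
have tkr : t * k%:R <= r%:R by rewrite -[r%:R]/(r%:Z%:~R) rc ceil_ge.
have [/andP[d0 _] rip _] := hdelta; rewrite -/c -/r in rip.
have [Uh [h [Vh svdH]]] := svd_exists (Xs - X) hn.
have /is_svdP[[UU VV h0 HE] hs] := svdH.
have nsp := sparse_null_space_property r1 rk (ltnW hkn) t0 tkr
  (RIP_sparse UU VV rip) d0 hbound h0 hs.
rewrite -measure_map_svd -HE -l2normE in nsp.
have [hS _] := (is_svdP _ _ _ _).1 hsvd.
rewrite (nuclear_norm_tail k hsvd).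
apply: (error_arithmetic hk0 (beta1_gt0 t0 d0 hbound) (beta2_ge0 t0 d0 hbound)
  (beta2_lt1 t0 d0 hbound) hlambda heps _ _ nsp).
- by apply: sumr_ge0 => i _; case: hS.
- by apply: sumr_ge0.
- apply: le_trans (optimality_inequality hlambda he hb hXs) _.
  rewrite ler_pM2l ?mulr_gt0// -[in nuclear_norm Xs](subrKC X Xs).
  apply: le_trans (nuclear_norm_cone k hn hsvd svdH) _.
  by rewrite lerD2r lerD2l head_sum_le// ltnW.
rewrite (_ : frobenius_norm _ = Num.sqrt (\sum_i h 0 i ^+ 2)).
  exact: (norm_le_head_tail (x := h 0) hk0 (ltnW hkn) h0 hs).
rewrite -[LHS]ger0_norm ?sqrtr_ge0// -sqrtr_sqr frobenius_norm_sqr.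
by rewrite HE mxdot_svd.
Qed.
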